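(* Let $A\in\mathscr{B}(\mathscr{H})$. Then \[ \omega(A)^2\le \inf_{0\le t\le 1}\left\|\frac{|A|^{4(1-t)}+|A^*|^{4t}}{4}+\frac{(1-t)|A|^2+t|A^*|^2}{2}\right\|. \]
   Context: $\mathscr{B}(\mathscr{H})$ is the $C^*$-algebra of all bounded linear operators on a complex Hilbert space $\mathscr{H}$ with inner product $\langle\cdot,\cdot\rangle$. For $T\in\mathscr{B}(\mathscr{H})$: $\omega(T)=\sup_{\|x\|=1}|\langle Tx,x\rangle|$ is the numerical radius and $\omega(T)^2$ means $(\omega(T))^2$; $\|T\|=\sup_{\|x\|=1}\|Tx\|$ is the operator norm; $T^*$ is the adjoint; $|T|=(T^*T)^{1/2}$. Real powers of positive operators are defined by the continuous functional calculus, with $T^0=I$. *)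

(* Defs.v *)
From HB Require Import structures.
From mathcomp Require Import all_boot all_order all_algebra.
From mathcomp Require Import complex.
From mathcomp Require Import all_classical all_reals all_analysis.

Set Implicit Arguments.
Unset Strict Implicit.
Unset Printing Implicit Defensive.

Import Order.TTheory GRing.Theory Num.Theory.
Import numFieldNormedType.Exports.

Local Open Scope classical_set_scope.
Local Open Scope complex_scope.
Local Open Scope ring_scope.

Section BoundedOperators.
Variables (R : realType) (H : completeNormedModType R[i]).
Implicit Types (T S : H -> H).

Definition bounded_op T := linear T /\ continuous T.

(* The norm of H takes its values in R[i]; these are real, hence the real parts
   below. *)
Definition opnorm T : R :=
  sup [set complex.Re `|T x| | x in [set x : H | `|x| = 1]].

Definition poly_op (p : {poly R[i]}) T : H -> H :=
  fun x => \sum_(i < size p) p`_i *: iter i T x.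

Definition spectrum T : set R[i] :=
  [set z | ~ exists S, [/\ bounded_op S, cancel (fun x => T x - z *: x) S
                         & cancel S (fun x => T x - z *: x)]].

(* S is the norm limit of p_n(T) for some polynomials p_n converging uniformly
   to f on the spectrum of T. When T is bounded self-adjoint and f is continuous
   on the spectrum, there is exactly one such S, the value f(T) of the
   continuous functional calculus. *)
Definition is_cfc T (f : R[i] -> R[i]) S :=
  bounded_op S /\
  exists p : nat -> {poly R[i]},
    (forall e : R, 0 < e -> \forall n \near \oo,
       forall z, spectrum T z -> `|(p n).[z] - f z| <= e%:C) /\
    opnorm (poly_op (p n) T - S) @[n --> \oo] --> (0 : R).

Definition cfc T (f : R[i] -> R[i]) : H -> H := xget 0 [set S | is_cfc T f S].

(* For T positive: the spectrum lies in [0, +oo), so the real part is harmless;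
   powR x 0 = 1 for every x (including 0), which gives T^0 = I. *)
Definition op_powR T (s : R) : H -> H :=
  cfc T (fun z => ((complex.Re z) `^ s)%:C).

(* A form {dot H for conjC} is linear in its first argument and conjugate-linear
   in the second. *)
Variable dot : {dot H for Num.conj}.

Definition numerical_radius T : R :=
  sup [set complex.Re `|dot (T x) x| | x in [set x : H | `|x| = 1]].

Definition adjoint T : H -> H :=
  xget 0 [set S | bounded_op S /\ forall x y, dot (T x) y = dot x (S y)].

Definition op_abs T : H -> H := op_powR (adjoint T \o T) 2^-1.

End BoundedOperators.

(* Main.v *)
Require Import Defs.
From HB Require Import structures.
From mathcomp Require Import all_boot all_order all_algebra.
From mathcomp Require Import complex.
From mathcomp Require Import all_classical all_reals all_analysis.
From mathcomp Require Import ring lra.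

Set Implicit Arguments.
Unset Strict Implicit.
Unset Printing Implicit Defensive.

Import Order.TTheory GRing.Theory Num.Theory.
Import numFieldNormedType.Exports.

Local Open Scope classical_set_scope.
Local Open Scope complex_scope.
Local Open Scope ring_scope.

(** Let x be a unit vector, p = <|A|^(2(1-t)) x, x> and q = <|A^*|^(2t) x, x>.
The mixed Schwarz inequality |<A x, x>|^2 <= p q ([mixed_schwarz]) and
p q = p q / 2 + p q / 2 <= (p^2 + q^2) / 4 + p q / 2 reduce the theorem to two
scalar inequalities that pass to operators because the functional calculus is
positive ([calculus_affine_le]).  Replacing r^(2(1-t)) by its tangent
m^2 + r^(4(1-t)) >= 2 m r^(2(1-t)) at m = p gives p^2 <= <|A|^(4(1-t)) x, x>, and
likewise for q.  Young's inequality v^(2(1-t)) w^(2t) <= (1-t) v^2 + t w^2, read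
with v replaced by |A| and afterwards with w replaced by |A^*|, gives
p q <= (1-t) <|A|^2 x, x> + t <|A^*|^2 x, x>.  The total is the quadratic form at
x of the operator in the theorem, hence at most its norm.

The mixed Schwarz inequality is obtained without a polar decomposition.  For
e > 0 the operator F = |A|^(2(1-t)) + e is positive and its inverse G is again a
function of |A|, so the Cauchy-Schwarz inequality for the form of F gives
|<x, A^* x>|^2 <= <F x, x> <G A^* x, A^* x>.  Functions of |A| and |A^*| are
intertwined by A ([calculus_intertwine]), which turns the last factor into the
form of the function r^2 / (r^(2(1-t)) + e) <= r^(2t) of |A^*|; then e tends to 0.

All properties of the functional calculus of a positive operator T rest on one
estimate ([poly_op_spectral_bound]): a polynomial q with |q| <= e on the spectrum
satisfies ||q(T)|| <= e.  The bound has to involve the spectrum itself, since this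
is the only place where polynomials defining f(T) are controlled.  It holds
because the supremum of the form of q(T)^* q(T) is an approximate eigenvalue of
that operator; splitting the corresponding polynomial into linear factors over
the complex numbers shows that this supremum is |q(z)|^2 for some z in the
spectrum.  Existence of f(T) follows from this and Weierstrass approximation on
an interval [0, M] containing the spectrum ([psd_spectrum], [weierstrass]). *)

(** * Real-valued norms and inner products *)

Section RealNorm.
Variables (R : realType) (V : normedZmodType R[i]).
Implicit Types (x y : V).

(** Norms take their values in the complex numbers; ordered-field reasoning is
easier on their real parts.  The definition also covers the modulus of a
complex number. *)
Definition rnorm x : R := complex.Re `|x|.

Lemma rnormE x : `|x| = (rnorm x)%:C.
Proof. by rewrite /rnorm RRe_real// normr_real. Qed.

Lemma rnorm_ge0 x : 0 <= rnorm x.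
Proof. by rewrite -ler0c -rnormE. Qed.

Lemma rnorm0 : rnorm 0 = 0.
Proof. by rewrite /rnorm normr0. Qed.

Lemma rnorm0_eq0 x : rnorm x = 0 -> x = 0.
Proof. by move=> nx; apply/eqP; rewrite -normr_eq0 rnormE nx. Qed.

Lemma rnormN x : rnorm (- x) = rnorm x.
Proof. by rewrite /rnorm normrN. Qed.

Lemma rnormBC x y : rnorm (x - y) = rnorm (y - x).
Proof. by rewrite -rnormN opprB. Qed.

Lemma rnormD x y : rnorm (x + y) <= rnorm x + rnorm y.
Proof. by rewrite -lecR rmorphD/= -!rnormE ler_normD. Qed.

Lemma rnormB x y : rnorm (x - y) <= rnorm x + rnorm y.
Proof. by rewrite -(rnormN y) rnormD. Qed.

Lemma rnorm_dist x y z : rnorm (x - z) <= rnorm (x - y) + rnorm (y - z).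
Proof. by rewrite (le_trans _ (rnormD _ _))// addrA subrK. Qed.

Lemma rnorm_split x y : rnorm x <= rnorm (x - y) + rnorm y.
Proof. by rewrite (le_trans _ (rnormD _ _))// subrK. Qed.

End RealNorm.

Section ComplexModulus.
Variable R : realType.
Implicit Types (z w : R[i]) (r : R).

Lemma rnormM z w : rnorm (z * w) = rnorm z * rnorm w.
Proof. by apply: complexI; rewrite rmorphM/= -!rnormE normrM. Qed.

Lemma rnormC r : rnorm r%:C = `|r|.
Proof.
by apply: complexI; rewrite -rnormE normc_def/= expr0n/= addr0 sqrtr_sqr.
Qed.

Lemma rnorm_conj z : rnorm (Num.conj z) = rnorm z.
Proof. by rewrite /rnorm norm_conjC. Qed.

Lemma conjE z : Num.conj z = complex.Re z -i* complex.Im z.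
Proof. by case: z. Qed.

Lemma conj_real r : Num.conj (r%:C : R[i]) = r%:C.
Proof. by rewrite conjE/= oppr0. Qed.

Lemma rnorm_sqr z : rnorm z ^+ 2 = complex.Re z ^+ 2 + complex.Im z ^+ 2.
Proof. by apply: complexI; rewrite rmorphXn/= -rnormE add_Re2_Im2. Qed.

Lemma mul_conj_rnorm z : z * Num.conj z = (rnorm z ^+ 2)%:C.
Proof. by rewrite -normCK rnormE rmorphXn. Qed.

Lemma Re_le_rnorm z : complex.Re z <= rnorm z.
Proof.
rewrite (le_trans (ler_norm _))// -ler_sqr ?nnegrE ?rnorm_ge0// rnorm_sqr.
by rewrite real_normK ?num_real// lerDl sqr_ge0.
Qed.

End ComplexModulus.

Section InnerProduct.
Variables (R : realType) (H : normedModType R[i]) (dot : {dot H for Num.conj}).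
Hypothesis Hdot : forall x : H, dot x x = `|x| ^+ 2.
Implicit Types (x y : H) (T S : H -> H) (a : R[i]) (r : R).

Definition rdot x y : R := complex.Re (dot x y).

Lemma rnormZ a x : rnorm (a *: x) = rnorm a * rnorm x.
Proof. by apply: complexI; rewrite rmorphM/= -!rnormE normrZ. Qed.

Lemma rnormZr r x : rnorm (r%:C *: x) = `|r| * rnorm x.
Proof. by rewrite rnormZ rnormC. Qed.

Lemma dot_rnorm x : dot x x = (rnorm x ^+ 2)%:C.
Proof. by rewrite Hdot rnormE rmorphXn. Qed.

Lemma rdot_rnorm x : rdot x x = rnorm x ^+ 2.
Proof. by rewrite /rdot dot_rnorm. Qed.

Lemma dotC x y : dot x y = Num.conj (dot y x).
Proof. by rewrite hermC/= expr0 mul1r. Qed.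

Lemma rdotC x y : rdot x y = rdot y x.
Proof. by rewrite /rdot dotC conjE. Qed.

Lemma dotDl x y z : dot (x + y) z = dot x z + dot y z.
Proof. by rewrite linearDl. Qed.

Lemma dotDr x y z : dot z (x + y) = dot z x + dot z y.
Proof. by rewrite linearDr. Qed.

Lemma dotNl x z : dot (- x) z = - dot x z.
Proof. by rewrite linearNl. Qed.

Lemma dotNr x z : dot z (- x) = - dot z x.
Proof. by rewrite linearNr. Qed.

Lemma dotZl a x z : dot (a *: x) z = a * dot x z.
Proof. by rewrite linearZl_LR. Qed.

Lemma dotZr a x z : dot z (a *: x) = Num.conj a * dot z x.
Proof. by rewrite linearZr_LR. Qed.

Lemma rdotDl x y z : rdot (x + y) z = rdot x z + rdot y z.
Proof. by rewrite /rdot dotDl raddfD. Qed.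

Lemma rdotNl x z : rdot (- x) z = - rdot x z.
Proof. by rewrite /rdot dotNl raddfN. Qed.

Lemma rdotBl x y z : rdot (x - y) z = rdot x z - rdot y z.
Proof. by rewrite rdotDl rdotNl. Qed.

Lemma rdotZl r x z : rdot (r%:C *: x) z = r * rdot x z.
Proof. by rewrite /rdot dotZl; case: (dot x z) => a b /=; rewrite mul0r subr0. Qed.

Lemma rdotDr x y z : rdot z (x + y) = rdot z x + rdot z y.
Proof. by rewrite !(rdotC z) rdotDl. Qed.

Lemma rdotNr x z : rdot z (- x) = - rdot z x.
Proof. by rewrite !(rdotC z) rdotNl. Qed.

Lemma rdotBr x y z : rdot z (x - y) = rdot z x - rdot z y.
Proof. by rewrite rdotDr rdotNr. Qed.

Lemma rdotZr r x z : rdot z (r%:C *: x) = r * rdot z x.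
Proof. by rewrite !(rdotC z) rdotZl. Qed.

Lemma dot_inj x y : (forall z, dot x z = dot y z) -> x = y.
Proof.
move=> xy; apply/eqP; rewrite -subr_eq0; apply/eqP/rnorm0_eq0.
have : rdot (x - y) (x - y) = 0 by rewrite rdotBl /rdot xy subrr.
by rewrite rdot_rnorm => /eqP; rewrite sqrf_eq0 => /eqP.
Qed.

Lemma rnorm_sqrB x y : rnorm (x - y) ^+ 2 = rnorm x ^+ 2 - 2 * rdot x y + rnorm y ^+ 2.
Proof.
rewrite -!rdot_rnorm !(rdotBl, rdotBr) (rdotC y x); ring.
Qed.

Lemma rnorm_sqrD x y : rnorm (x + y) ^+ 2 = rnorm x ^+ 2 + 2 * rdot x y + rnorm y ^+ 2.
Proof.
rewrite -!rdot_rnorm !(rdotDl, rdotDr) (rdotC y x); ring.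
Qed.

Definition psd T := [/\ linear T, forall x y, dot (T x) y = dot x (T y)
                      & forall x, 0 <= rdot (T x) x].

(** The discriminant argument behind Cauchy-Schwarz.  The factor m common to the
linear and leading coefficients is what removes one power of m from the
discriminant inequality m^2 <= m b c. *)
Lemma quadratic_ge0 (m b c : R) : 0 <= m -> 0 <= b ->
  (forall s : R, 0 <= c - 2 * s * m + s ^+ 2 * m * b) -> m <= b * c.
Proof.
move=> m0 b0 hs; have [b00|bn0] := eqVneq b 0; last first.
  have bgt0 : 0 < b by rewrite lt_def bn0.
  have := hs b^-1; rewrite -(pmulr_rge0 _ bgt0).
  have -> : b * (c - 2 * b^-1 * m + b^-1 ^+ 2 * m * b) = b * c - m by field.
  by rewrite subr_ge0.
rewrite b00 mul0r leNgt; apply/negP => m_gt0.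
have := hs ((c + 1) / (2 * m)); rewrite b00 mulr0 addr0.
have -> : c - 2 * ((c + 1) / (2 * m)) * m = - 1 by field; rewrite gt_eqF.
lra.
Qed.

Lemma linear_morphs T : linear T ->
  [/\ {morph T : x y / x + y}, {morph T : x y / x - y},
      (forall a x, T (a *: x) = a *: T x) & T 0 = 0].
Proof.
move=> lT; have T0 : T 0 = 0.
  by have := lT 1 0 0; rewrite !scale1r addr0 => /(congr1 (fun u => u - T 0));
    rewrite addrK subrr.
have TZ a x : T (a *: x) = a *: T x.
  by have := lT a x 0; rewrite !addr0 T0 addr0.
split => //; first by move=> x y; have := lT 1 x y; rewrite !scale1r.
by move=> x y; have := lT (-1) y x; rewrite !scaleN1r ![- _ + _]addrC.
Qed.

(** Since <T y, y> may vanish, <T (x - c y), x - c y> >= 0 is used for all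
c = s <T x, y> with s real, not only for the optimal c. *)
Lemma psd_cauchy_schwarz T x y : psd T ->
  rnorm (dot (T x) y) ^+ 2 <= rdot (T y) y * rdot (T x) x.
Proof.
move=> [lT sT pT]; have [TD TB TZ T0] := linear_morphs lT.
apply: quadratic_ge0 => //; first by rewrite sqr_ge0.
move=> s; set a := dot (T x) y.
have := pT (x - (s%:C * a) *: y).
rewrite TB TZ rdotBl !rdotBr.
have E1 : rdot (T x) ((s%:C * a) *: y) = s * rnorm a ^+ 2.
  rewrite /rdot dotZr rmorphM/= -/a -mulrA [_ * a]mulrC mul_conj_rnorm conj_real.
  by rewrite -rmorphM.
have E2 : rdot ((s%:C * a) *: T y) x = s * rnorm a ^+ 2.
  by rewrite rdotC -E1 /rdot !dotZr (sT x).
have E3 : rdot ((s%:C * a) *: T y) ((s%:C * a) *: y)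
    = s ^+ 2 * rnorm a ^+ 2 * rdot (T y) y.
  rewrite /rdot dotZl dotZr mulrA mul_conj_rnorm rnormM exprMn rnormC real_normK ?num_real//.
  by case: (dot (T y) y) => u v /=; rewrite mul0r subr0.
rewrite E1 E2 E3 => h; move: h.
set p := rdot (T x) x; set q := rdot (T y) y; set m := rnorm a; nra.
Qed.

Lemma cauchy_schwarz x y : rnorm (dot x y) <= rnorm x * rnorm y.
Proof.
rewrite -ler_sqr ?nnegrE ?mulr_ge0 ?rnorm_ge0//.
have := @psd_cauchy_schwarz id x y; rewrite !rdot_rnorm exprMn mulrC; apply.
by split => // z; rewrite rdot_rnorm sqr_ge0.
Qed.

Lemma rdot_le x y : rdot x y <= rnorm x * rnorm y.
Proof. exact: le_trans (Re_le_rnorm _) (cauchy_schwarz x y). Qed.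

End InnerProduct.

(** * Bounded operators and completeness *)

Section BoundedOps.
Variables (R : realType) (H : completeNormedModType R[i]).
Implicit Types (x y : H) (T S : H -> H).

Definition bounded_by (K : R) T := forall x, rnorm (T x) <= K * rnorm x.

Lemma bounded_by_le K L T : K <= L -> bounded_by K T -> bounded_by L T.
Proof. by move=> KL TK x; rewrite (le_trans (TK x))// ler_wpM2r ?rnorm_ge0. Qed.

(** Continuity of a linear map is traded for an explicit bound, which is the form
used in all estimates below. *)
Lemma bounded_opP T :
  bounded_op T <-> linear T /\ exists2 K, 0 <= K & bounded_by K T.
Proof.
split=> [[lT cT]|[lT [K K0 TK]]]; split => //.
  pose f := HB.pack_for {linear H -> H} T
    (GRing.isLinear.Build R[i] H H _ T lT).
  have /linear_boundedP/pinfty_ex_gt0[M M0 TM] : bounded_near f (nbhs (0 : H)).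
    exact/linear_bounded_continuous.
  have M1 : M = (complex.Re M)%:C by rewrite RRe_real// gtr0_real.
  exists (complex.Re M); first by rewrite -ler0c -M1 ltW.
  by move=> x; rewrite -lecR rmorphM/= -!rnormE -M1; exact: TM.
pose f := HB.pack_for {linear H -> H} T
  (GRing.isLinear.Build R[i] H H _ T lT).
apply: (@bounded_linear_continuous _ _ _ f); apply/linear_boundedP.
exists K%:C; split; first by rewrite ger0_real// ler0c.
move=> M KM x; rewrite (le_trans _ (ler_wpM2r _ (ltW KM)))//.
by rewrite !rnormE -rmorphM lecR TK.
Qed.

Lemma bounded_op_lin T : bounded_op T -> linear T.
Proof. by case. Qed.

Lemma opnorm_has_ubound T : bounded_op T ->
  has_ubound [set complex.Re `|T x| | x in [set x : H | `|x| = 1]].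
Proof.
move=> /bounded_opP[_ [K K0 TK]]; exists K => _ [x /= x1 <-].
by rewrite -/(rnorm (T x)) (le_trans (TK x))// /rnorm x1 mulr1.
Qed.

Lemma normalize x : x != 0 -> rnorm (((rnorm x)^-1)%:C *: x) = 1.
Proof.
move=> x0; have n0 : rnorm x != 0 by apply: contra_neq x0 => /rnorm0_eq0.
by rewrite rnormZr ger0_norm ?invr_ge0 ?rnorm_ge0// mulVf.
Qed.

Lemma normalizeK x : x = (rnorm x)%:C *: (((rnorm x)^-1)%:C *: x).
Proof.
have [->|x0] := eqVneq x 0; first by rewrite !scaler0.
have n0 : rnorm x != 0 by apply: contra_neq x0 => /rnorm0_eq0.
by rewrite scalerA -rmorphM/= mulfV// scale1r.
Qed.

Lemma opnorm_bound T : bounded_op T -> bounded_by (opnorm T) T.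
Proof.
move=> bT x; have [_ _ TZ T0] := linear_morphs (bounded_op_lin bT).
have [->|x0] := eqVneq x 0; first by rewrite T0 !rnorm0 mulr0.
have y1 : `|((rnorm x)^-1)%:C *: x| = 1 by rewrite rnormE normalize.
rewrite {1}[x]normalizeK TZ rnormZr mulrC ger0_norm ?rnorm_ge0// ler_wpM2r ?rnorm_ge0//.
have hs : has_sup [set complex.Re `|T x| | x in [set x : H | `|x| = 1]].
  split; last exact: opnorm_has_ubound.
  by exists (rnorm (T (((rnorm x)^-1)%:C *: x))), (((rnorm x)^-1)%:C *: x).
by apply: (sup_upper_bound hs); exists (((rnorm x)^-1)%:C *: x).
Qed.

Lemma opnorm_le K T : 0 <= K -> bounded_by K T -> opnorm T <= K.
Proof.
move=> K0 TK; rewrite /opnorm; set A := (X in sup X).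
have [->|/set0P A0] := eqVneq A set0; first by rewrite sup0.
apply: ge_sup => // _ [x /= x1 <-].
by rewrite -/(rnorm (T x)) (le_trans (TK x))// /rnorm x1 mulr1.
Qed.

Lemma opnorm_ge0 T : 0 <= opnorm T.
Proof.
rewrite /opnorm; set A := (X in sup X).
have [[[y Ay] hA]|nA] := pselect (has_sup A); last by rewrite sup_out.
apply: (le_trans _ (sup_upper_bound _ Ay)); last by split => //; exists y.
by case: Ay => x _ <-; exact: rnorm_ge0.
Qed.

(** Completeness with a modulus: the Cauchy rate is also a rate of convergence,
so that no limit has to be taken in later estimates. *)
Lemma complete_rate (u : nat -> H) (e : nat -> R) :
    (forall n m, (n <= m)%N -> rnorm (u m - u n) <= e n) ->
    e @ \oo --> (0 : R) ->
  exists l, forall n, rnorm (l - u n) <= e n.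
Proof.
move=> ue e0.
have e_small (d : R) : 0 < d -> \forall n \near \oo, e n < d.
  move=> d0; have /cvgrPdist_lt/(_ _ d0) := e0; apply: filterS => n.
  by rewrite sub0r normrN => /(le_lt_trans (ler_norm _)).
have nearC (d : R[i]) : 0 < d -> d = (complex.Re d)%:C /\ 0 < complex.Re d.
  move=> d0; have E : d = (complex.Re d)%:C by rewrite RRe_real// gtr0_real.
  by split => //; rewrite -ltcR -E.
have cu : cvgn u.
  apply/cauchy_cvgP/cauchyP => d /nearC[-> d0].
  have [N _ eN] := e_small _ d0.
  exists (u N); exists N => // m /= Nm; rewrite -ball_normE/= rnormE ltcR rnormBC.
  by rewrite (le_lt_trans (ue _ _ Nm))// eN//=.
exists (limn u) => n; apply/ler_addgt0Pr => d d0.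
have /cvgrPdist_lt/(_ d%:C) := cu; rewrite ltcR => /(_ d0)[N _ uN].
pose k := maxn n N.
have := uN k (leq_maxr n N); rewrite rnormE ltcR => h1.
rewrite (le_trans (rnorm_dist _ (u k) _))// addrC lerD ?ue ?leq_maxl//.
exact: ltW.
Qed.

End BoundedOps.

(** * Riesz representation and adjoints *)

Section Adjoint.
Variables (R : realType) (H : completeNormedModType R[i]).
Variables (dot : {dot H for Num.conj}).
Hypothesis Hdot : forall x : H, dot x x = `|x| ^+ 2.
Implicit Types (x y : H) (T S : H -> H).
Local Notation rdot := (rdot dot).

(** Lets a parameter that can be taken equal to 1 / (n + 1) tend to 0 in an
inequality. *)
Lemma ge0_harmonic (a b : R) :
  (forall n, 0 <= a + b * n.+1%:R^-1) -> 0 <= a.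
Proof.
move=> h; rewrite leNgt; apply/negP => a0.
pose b1 := `|b| + 1; have b1_gt0 : 0 < b1 by rewrite ltr_pwDr.
have ab : 0 < - a / b1 by rewrite divr_gt0// oppr_gt0.
have [N _ /(_ N (leqnn _))/= hN] := near_infty_natSinv_lt (PosNum ab).
have := h N; rewrite leNgt => /negP; apply; set w := N.+1%:R^-1 in hN *.
have h1 : w * b1 < - a by rewrite -ltr_pdivlMr.
have h2 : b * w <= w * b1.
  by rewrite mulrC ler_wpM2l// ?invr_ge0// /b1 ler_wpDr// ler_norm.
by rewrite (le_lt_trans (lerD (lexx a) h2))// -ltrBrDl sub0r.
Qed.

Lemma minimizer_critical (c h2 : R) : 0 <= h2 ->
  (forall t : R, 0 <= t ^+ 2 * h2 + 2 * t * c) -> c = 0.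
Proof.
(* The exact minimizer is -c / h2; adding 1 avoids dividing by zero. *)
move=> h20 /(_ (- c / (h2 + 1))).
have -> : (- c / (h2 + 1)) ^+ 2 * h2 + 2 * (- c / (h2 + 1)) * c
  = - (c ^+ 2 * ((h2 + 2) / (h2 + 1) ^+ 2)).
  by field; rewrite gt_eqF// ltr_wpDl.
rewrite oppr_ge0 pmulr_lle0; last by rewrite divr_gt0// ?exprn_gt0// ltr_wpDl.
by move=> c2; apply/eqP; rewrite -sqrf_eq0 eq_le c2 sqr_ge0.
Qed.

(** The vector representing phi is the minimizer of J x = |x|^2 - 2 Re (phi x):
the parallelogram law makes minimizing sequences Cauchy, and the derivative of
J vanishes at the limit. *)
Lemma riesz (phi : H -> R[i]) (K : R) :
    (forall a x y, phi (a *: x + y) = a * phi x + phi y) ->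
    (forall x, rnorm (phi x) <= K * rnorm x) ->
  exists v, forall x, phi x = dot x v.
Proof.
move=> lphi bphi.
pose J x := rnorm x ^+ 2 - 2 * complex.Re (phi x).
have phi0 : phi 0 = 0.
  have := lphi 1 0 0; rewrite scale1r addr0 mul1r.
  by move/(congr1 (fun u => u - phi 0)); rewrite addrK subrr.
have phiD x y : complex.Re (phi (x + y)) = complex.Re (phi x) + complex.Re (phi y).
  by rewrite -[x]scale1r lphi mul1r scale1r raddfD.
have phiZ (r : R) x : complex.Re (phi (r%:C *: x)) = r * complex.Re (phi x).
  rewrite -[_ *: x]addr0 lphi phi0 addr0.
  by case: (phi x) => a b /=; rewrite mul0r subr0.
have JK x : - K ^+ 2 <= J x.
  have h1 := Re_le_rnorm (phi x); have h2 := bphi x.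
  have : 0 <= (rnorm x - K) ^+ 2 by exact: sqr_ge0.
  rewrite /J; nra.
have hJ : has_inf (range J).
  by split; [exists (J 0), 0 | exists (- K ^+ 2) => _ [x _ <-]; exact: JK].
pose m := inf (range J).
have mJ x : m <= J x by apply: (inf_lbound hJ.2); exists x.
pose d (n : nat) : R := n.+1%:R^-1.
have d_gt0 n : 0 < d n by rewrite invr_gt0.
(* The square turns into the rate 2 * d n under the parallelogram law. *)
have /choice[u uJ] (n : nat) : exists x, J x <= m + d n ^+ 2.
  have [_ [x _ <-] Jx] := inf_adherent (exprn_gt0 2 (d_gt0 n)) hJ.
  by exists x; exact: ltW.
have Jpar x y : rnorm (x - y) ^+ 2 <= 2 * (J x + J y) - 4 * m.
  have := mJ (2^-1%:C *: (x + y)); rewrite /J rnormZr phiZ phiD exprMn.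
  rewrite (rnorm_sqrB Hdot) (rnorm_sqrD Hdot) real_normK ?num_real//.
  by set a := rdot x y; set b := rnorm x ^+ 2; set e := rnorm y ^+ 2; lra.
have ucauchy n k : (n <= k)%N -> rnorm (u k - u n) <= 2 * d n.
  move=> nk; rewrite -ler_sqr ?nnegrE ?rnorm_ge0 ?mulr_ge0 ?(ltW (d_gt0 _))//.
  have dd : d k ^+ 2 <= d n ^+ 2.
    by rewrite ler_sqr ?nnegrE ?(ltW (d_gt0 _))// lef_pV2 ?posrE// ler_nat ltnS.
  have := Jpar (u k) (u n); have := uJ k; have := uJ n.
  rewrite exprMn; lra.
have [|v uv] := complete_rate ucauchy.
  rewrite -[X in _ --> X](mulr0 2); apply: cvgMr => //; exact: cvg_harmonic.
exists v.
have key h : complex.Re (phi h) = complex.Re (dot h v).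
  apply/eqP; rewrite eq_sym -subr_eq0; apply/eqP.
  apply: (minimizer_critical (sqr_ge0 (rnorm h))) => t.
  apply: (@ge0_harmonic _ (4 * `|t| * rnorm h + 1)) => n; rewrite -/(d n).
  have := mJ (u n + t%:C *: h); rewrite /J (rnorm_sqrD Hdot) rnormZr exprMn phiD phiZ.
  rewrite real_normK ?num_real// rdotZr.
  have := uJ n; rewrite {1}/J.
  have : d n ^+ 2 <= d n.
    by rewrite expr2 ger_pMl ?d_gt0// invf_le1// ler1n.
  have : t * rdot (u n) h - t * rdot v h <= `|t| * (2 * d n * rnorm h).
    rewrite -mulrBr -rdotBl (le_trans (ler_norm _))// normrM.
    rewrite ler_wpM2l// ler_norml; apply/andP; split.
      rewrite lerNl -rdotNl (le_trans (rdot_le Hdot _ _))// opprB.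
      by rewrite ler_wpM2r ?rnorm_ge0.
    by rewrite (le_trans (rdot_le Hdot _ _))// rnormBC ler_wpM2r ?rnorm_ge0.
  rewrite (_ : complex.Re (dot h v) = rdot v h); last exact: rdotC.
  set a := rdot (u n) h; set b := rdot v h; set p := `|t|; set dn := d n.
  set q := rnorm h; set r := complex.Re _; set s := complex.Re _.
  nra.
move=> h; apply/eqP; rewrite eq_complex key eqxx/=.
have := key ('i *: h); rewrite -[_ *: h]addr0 lphi phi0 !addr0 dotZl.
case: (phi h) (dot h v) => a b [c e] /=; rewrite !mul0r !mul1r !sub0r.
by move/oppr_inj => ->.
Qed.

Definition adjoint_of T S := forall x y, dot (T x) y = dot x (S y).

Lemma adjoint_ofC T S : adjoint_of T S -> adjoint_of S T.
Proof. by move=> TS x y; rewrite (dotC dot) -TS -(dotC dot). Qed.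

Lemma adjoint_of_inj T S S' : adjoint_of T S -> adjoint_of T S' -> S = S'.
Proof.
move=> TS TS'; apply/funext => y; apply: (dot_inj Hdot) => z.
by rewrite (dotC dot) -TS TS' -(dotC dot).
Qed.

Lemma adjoint_exists T : bounded_op T -> exists S, bounded_op S /\ adjoint_of T S.
Proof.
move=> /bounded_opP[lT [K K0 TK]]; have [TD TB TZ T0] := linear_morphs lT.
have /choice[S TS] (y : H) : exists v, forall x, dot (T x) y = dot x v.
  apply: (@riesz _ (K * rnorm y)) => [a x z|x].
    by rewrite lT dotDl dotZl.
  rewrite (le_trans (cauchy_schwarz Hdot _ _))// mulrAC ler_wpM2r ?rnorm_ge0//.
have adjTS : adjoint_of T S by [].
exists S; split => //; apply/bounded_opP; split.
  move=> a x y; apply: (dot_inj Hdot) => z.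
  rewrite (dotC dot) -TS (dotDl dot) (dotZl dot) dotDr dotZr !TS rmorphD rmorphM/=.
  by rewrite conjCK -!(dotC dot).
exists K => // y; have [->|Sy0] := eqVneq (rnorm (S y)) 0.
  by rewrite mulr_ge0 ?rnorm_ge0.
have Sy_gt0 : 0 < rnorm (S y) by rewrite lt_def Sy0 rnorm_ge0.
rewrite -(ler_pM2l Sy_gt0) -expr2 -(rdot_rnorm Hdot) /rdot -TS.
rewrite (le_trans (Re_le_rnorm _))// (le_trans (cauchy_schwarz Hdot _ _))//.
by rewrite mulrA ler_wpM2r ?rnorm_ge0// mulrC.
Qed.

Lemma adjointP T : bounded_op T ->
  bounded_op (adjoint dot T) /\ adjoint_of T (adjoint dot T).
Proof.
move=> bT; have [S [bS TS]] := adjoint_exists bT.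
pose P := [set S | bounded_op S /\ forall x y, dot (T x) y = dot x (S y)].
by apply: (@xgetPex _ 0 P); exists S.
Qed.

Lemma adjointK T : bounded_op T -> adjoint dot (adjoint dot T) = T.
Proof.
move=> bT; have [bS TS] := adjointP bT; have [_ ST] := adjointP bS.
exact: adjoint_of_inj ST (adjoint_ofC TS).
Qed.

End Adjoint.

(** * Coercive operators and the spectrum of a positive operator *)

Section Invertibility.
Variables (R : realType) (H : completeNormedModType R[i]).
Variables (dot : {dot H for Num.conj}).
Hypothesis Hdot : forall x : H, dot x x = `|x| ^+ 2.
Implicit Types (x y : H) (T S : H -> H).
Local Notation rdot := (rdot dot).
Local Notation psd := (psd dot).

(** The solution is the fixed point of x |-> y + T x. *)
Lemma neumann T (q : R) y : linear T -> bounded_by q T -> 0 <= q < 1 ->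
  exists x, x - T x = y.
Proof.
move=> lT Tq /andP[q0 q1]; have [TD TB TZ T0] := linear_morphs lT.
pose u n := iter n (fun x => y + T x) 0; pose C := rnorm y / (1 - q).
have q1_gt0 : 0 < 1 - q by rewrite subr_gt0.
have C0 : 0 <= C by rewrite divr_ge0 ?rnorm_ge0// ltW.
have uC n : rnorm (u n) <= C.
  elim: n => [|n IH]; first by rewrite rnorm0.
  rewrite /= (le_trans (rnormD _ _))//.
  have -> : C = rnorm y + q * C by rewrite /C; field; rewrite gt_eqF.
  by rewrite lerD2l (le_trans (Tq _))// ler_wpM2l.
have ucauchy n m : (n <= m)%N -> rnorm (u m - u n) <= geometric C q n.
  move=> /subnK <-; rewrite addnC; move: (m - n)%N => k.
  elim: n => [|n IH]; first by rewrite subr0 /geometric/= mulr1.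
  rewrite addSn /= opprD addrACA subrr add0r -TB (le_trans (Tq _))//.
  by rewrite /geometric/= exprS mulrCA ler_wpM2l.
have geo0 : geometric C q @ \oo --> (0 : R).
  by apply: cvg_geometric; rewrite ger0_norm.
have [x xu] := complete_rate ucauchy geo0.
exists x; apply/eqP; rewrite -subr_eq0; apply/eqP/rnorm0_eq0/eqP.
rewrite eq_le rnorm_ge0 andbT.
have bnd n : rnorm (x - T x - y) <= 2 * geometric C q n.
  have -> : x - T x - y = (x - u n.+1) - T (x - u n).
    by rewrite TB opprB /u iterS -/(u n) opprD !addrA subrK addrAC.
  rewrite (le_trans (rnormB _ _))// mulr_natl mulr2n lerD//.
    rewrite (le_trans (xu _))// /geometric/= ler_wpM2l//.
    by rewrite exprS ler_piMl ?exprn_ge0// ltW.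
  rewrite (le_trans (Tq _))// (le_trans (ler_wpM2l q0 (xu n)))//.
  by rewrite ler_piMl ?(ltW q1)// /geometric/= mulr_ge0 ?exprn_ge0.
have lim0 : (fun n => 2 * geometric C q n) @ \oo --> (0 : R).
  by rewrite -[X in _ --> X](mulr0 2); exact: cvgMr.
by apply: (cvgr_to_ge lim0); exact: nearW.
Qed.

(** For small s > 0 the operator 1 - s T is a strict contraction, because
|x - s T x|^2 = |x|^2 - 2 s Re <T x, x> + s^2 |T x|^2; so s T is onto. *)
Lemma coercive_inverse T (c : R) : bounded_op T -> 0 < c ->
    (forall x, c * rnorm x ^+ 2 <= rdot (T x) x) ->
  exists S, [/\ bounded_op S, cancel T S & cancel S T].
Proof.
move=> bT c0 cT; have /bounded_opP[lT [K0 K00 TK0]] := bT.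
have [TD TB TZ T0] := linear_morphs lT.
have lower x : c * rnorm x <= rnorm (T x).
  have [->|x0] := eqVneq (rnorm x) 0; first by rewrite mulr0 rnorm_ge0.
  have x_gt0 : 0 < rnorm x by rewrite lt_def x0 rnorm_ge0.
  rewrite -(ler_pM2r x_gt0) -mulrA -expr2 (le_trans (cT x))//.
  exact: rdot_le.
have Tinj : injective T.
  move=> x y Txy; apply/eqP; rewrite -subr_eq0; apply/eqP/rnorm0_eq0/eqP.
  have := lower (x - y); rewrite TB Txy subrr rnorm0 pmulr_rle0// => h.
  by rewrite eq_le h rnorm_ge0.
pose K := K0 + c; have K_gt0 : 0 < K by rewrite ltr_wpDl.
have TK : bounded_by K T by apply: bounded_by_le TK0; rewrite lerDl ltW.
(* This s minimizes the upper bound 1 - 2 s c + s^2 K^2 of |1 - s T|^2. *)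
pose s := c / K ^+ 2.
pose D x := x - s%:C *: T x.
have lD : linear D.
  move=> a x y; rewrite /D lT !scalerDr !scalerN opprD addrACA !scalerA.
  by rewrite [_%:C * a]mulrC.
have cK : c <= K by rewrite lerDr.
have s_gt0 : 0 < s by rewrite divr_gt0 ?exprn_gt0.
pose q2 := 1 - s * c.
have sc : s * c <= 1.
  by rewrite mulrAC -expr2 ler_pdivrMr ?exprn_gt0// mul1r ler_sqr// nnegrE ltW.
have q2_ge0 : 0 <= q2 by rewrite subr_ge0.
have Dq x : rnorm (D x) <= Num.sqrt q2 * rnorm x.
  rewrite -ler_sqr ?nnegrE ?mulr_ge0 ?sqrtr_ge0 ?rnorm_ge0// exprMn sqr_sqrtr//.
  rewrite (rnorm_sqrB Hdot) rnormZr exprMn real_normK ?num_real// (rdotC dot) rdotZl.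
  have h1 := cT x; have h2 : rnorm (T x) ^+ 2 <= K ^+ 2 * rnorm x ^+ 2.
    by rewrite -exprMn ler_sqr ?nnegrE ?mulr_ge0 ?rnorm_ge0// ltW.
  have h3 : s * (c * rnorm x ^+ 2) <= s * rdot (T x) x by rewrite ler_wpM2l// ltW.
  have h4 : s ^+ 2 * rnorm (T x) ^+ 2 <= s * c * rnorm x ^+ 2.
    have -> : s * c * rnorm x ^+ 2 = s ^+ 2 * (K ^+ 2 * rnorm x ^+ 2).
      by rewrite /s; field; rewrite gt_eqF.
    by rewrite ler_wpM2l ?sqr_ge0.
  rewrite mulrA in h3; rewrite /q2 mulrBl mul1r.
  move: h3 h4; set a := s * c * _; set b := s * rdot _ _; set d := s ^+ 2 * _.
  lra.
have Dsurj z : exists x, x - D x = z.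
  apply: (neumann z lD Dq); rewrite sqrtr_ge0/= -[1]sqrtr1 ltr_sqrt//.
  by rewrite /q2 ltrBlDr ltrDl mulr_gt0.
have /choice[S TS] (y : H) : exists x, T x = y.
  have [x xD] := Dsurj (s%:C *: y); exists x.
  move: xD; rewrite /D opprB addrC subrK.
  by apply: scalerI; rewrite -[0]/(0%:C) (inj_eq (@complexI _)) gt_eqF.
have ST : cancel T S by move=> x; apply: Tinj.
exists S; split => //; apply/bounded_opP; split.
  by move=> a x y; apply: Tinj; rewrite lT !TS.
exists c^-1; first by rewrite invr_ge0 ltW.
by move=> x; rewrite -(ler_pM2l c0) mulrA mulfV ?gt_eqF// mul1r -{2}(TS x).
Qed.

Lemma bounded_opD T S : bounded_op T -> bounded_op S ->
  bounded_op (fun x => T x + S x).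
Proof.
move=> /bounded_opP[lT [K K0 TK]] /bounded_opP[lS [L L0 SL]].
apply/bounded_opP; split.
  by move=> a x y; rewrite lT lS scalerDr addrACA.
exists (K + L); first exact: addr_ge0.
by move=> x; rewrite mulrDl (le_trans (rnormD _ _))// lerD.
Qed.

Lemma bounded_opZ (a : R[i]) T : bounded_op T -> bounded_op (fun x => a *: T x).
Proof.
move=> /bounded_opP[lT [K K0 TK]]; apply/bounded_opP; split.
  by move=> b x y; rewrite lT scalerDr !scalerA mulrC.
exists (rnorm a * K); first by rewrite mulr_ge0 ?rnorm_ge0.
by move=> x; rewrite rnormZ -mulrA ler_wpM2l ?rnorm_ge0.
Qed.

Lemma bounded_op_id : bounded_op (fun x : H => x).
Proof.
by apply/bounded_opP; split => //; exists 1 => // x; rewrite mul1r.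
Qed.

Lemma bounded_op_comp T S : bounded_op T -> bounded_op S -> bounded_op (T \o S).
Proof.
move=> /bounded_opP[lT [K K0 TK]] /bounded_opP[lS [L L0 SL]].
apply/bounded_opP; split; first by move=> a x y /=; rewrite lS lT.
exists (K * L); first exact: mulr_ge0.
by move=> x; rewrite -mulrA (le_trans (TK _))// ler_wpM2l.
Qed.

Lemma rdot_bounded T (K : R) x : bounded_by K T -> rdot (T x) x <= K * rnorm x ^+ 2.
Proof.
move=> TK; rewrite (le_trans (rdot_le Hdot _ _))// expr2 mulrA.
by rewrite ler_wpM2r ?rnorm_ge0.
Qed.

Lemma psd_dotE T x : psd T -> dot (T x) x = (rdot (T x) x)%:C.
Proof.
move=> [_ sT _]; apply/eqP; rewrite eq_complex eqxx/=.
have := dotC dot (T x) x; rewrite -(sT x).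
by case: (dot (T x) x) => a b; rewrite conjE/= => -[] ?; apply/eqP; lra.
Qed.

(** The numerical range of T lies in [0, M].  If z does not, let t be the point of
[0, M] closest to Re z; after multiplication by the conjugate of t - z, the
operator T - z becomes coercive with constant |t - z|^2. *)
Lemma psd_spectrum T (M : R) z : 0 <= M -> psd T -> bounded_by M T ->
  spectrum T z -> exists2 r : R, 0 <= r <= M & z = r%:C.
Proof.
move=> M0 pT TM; have lT : linear T by case: pT.
have bT : bounded_op T by apply/bounded_opP; split => //; exists M.
case: z => a b; have [//|nz] := pselect (exists2 r : R, 0 <= r <= M & a +i* b = r%:C).
case.
pose t := Num.max 0 (Num.min a M).
have tM : 0 <= t <= M by rewrite /t le_max lexx ge_max M0 ge_min lexx orbT.
have nzt : (t - a) ^+ 2 + b ^+ 2 > 0.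
  rewrite lt_def addr_ge0 ?sqr_ge0// andbT paddr_eq0 ?sqr_ge0// !sqrf_eq0.
  rewrite subr_eq0; apply/negP => /andP[/eqP ta /eqP b0].
  by apply: nz; exists t => //; rewrite b0 ta.
pose w := (t - a) +i* b.
have w0 : w != 0 by apply: contraTneq nzt => -[-> ->]; rewrite expr0n/= addr0 ltxx.
pose C := fun x => T x - (a +i* b) *: x.
have bC : bounded_op C.
  apply: bounded_opD => //.
  have -> : (fun x : H => - ((a +i* b) *: x)) = (fun x => - (a +i* b) *: x).
    by apply/funext => x; rewrite scaleNr.
  exact: (bounded_opZ _ bounded_op_id).
have [_ _ CZ _] := linear_morphs (bounded_op_lin bC).
have [|S [bS CS SC]] := coercive_inverse (bounded_opZ w bC) nzt.
  move=> x; rewrite /rdot dotZl dotDl dotNl dotZl (dot_rnorm Hdot) (psd_dotE _ pT).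
  have t1 : rdot (T x) x <= M * rnorm x ^+ 2 by exact: rdot_bounded.
  have t0 : 0 <= rdot (T x) x by case: pT.
  move: t0 t1; set r := rdot (T x) x; set n2 := rnorm x ^+ 2 => t0 t1 /=.
  have n20 : 0 <= n2 by exact: sqr_ge0.
  have h : 0 <= (t - a) * (r - t * n2).
    rewrite /t; case: (leP a M) => aM; case: (leP 0 a) => a0.
    - by rewrite subrr mul0r.
    - by rewrite mul0r subr0 sub0r mulr_ge0// oppr_ge0 ltW.
    - rewrite (max_idPr M0); rewrite mulr_le0// subr_le0 ?t1// ltW//.
    - by move: (lt_trans aM a0); rewrite ltNge M0.
  nra.
exists (fun x => S (w *: x)); split.
- have -> : (fun x => S (w *: x)) = (S \o (fun x => w *: x)) by [].
  exact: bounded_op_comp bS (bounded_opZ _ bounded_op_id).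
- exact: CS.
- by move=> x; have := SC (w *: x) => /(scalerI w0).
Qed.

(** Being bounded below is the only trace of invertibility that is needed, and it
is stable under composition. *)
Lemma resolvent_bounded_below T z : ~ spectrum T z ->
  exists2 c : R, 0 < c & forall x, c * rnorm x <= rnorm (T x - z *: x).
Proof.
move=> /contrapT[S [bS TS ST]]; have /bounded_opP[_ [K K0 SK]] := bS.
have K1 : 0 < K + 1 by rewrite ltr_wpDl.
exists (K + 1)^-1; first by rewrite invr_gt0.
move=> x; rewrite mulrC ler_pdivrMr// mulrC -{1}(TS x).
by rewrite (le_trans (SK _))// ler_wpM2r ?rnorm_ge0// lerDl.
Qed.

End Invertibility.

(** * Polynomials in an operator *)

Section PolyOp.
Variables (R : realType) (H : completeNormedModType R[i]).
Variables (dot : {dot H for Num.conj}).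
Implicit Types (x y : H) (T S : H -> H) (p q : {poly R[i]}) (c : R[i]).

Lemma poly_opE T p n x : (size p <= n)%N ->
  poly_op p T x = \sum_(i < n) p`_i *: iter i T x.
Proof.
move=> pn; rewrite /poly_op (big_ord_widen n (fun i => p`_i *: iter i T x))//.
rewrite big_mkcond/=; apply: eq_bigr => i _.
by case: ltnP => // /(nth_default 0)->; rewrite scale0r.
Qed.

Lemma poly_opD T p q x : poly_op (p + q) T x = poly_op p T x + poly_op q T x.
Proof.
pose n := maxn (size p) (size q).
rewrite !(@poly_opE _ _ n) ?leq_maxl ?leq_maxr ?size_polyD// -big_split/=.
by apply: eq_bigr => i _; rewrite coefD scalerDl.
Qed.

Lemma poly_opZ T c p x : poly_op (c *: p) T x = c *: poly_op p T x.
Proof.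
rewrite !(@poly_opE _ _ (size p)) ?size_scale_leq// scaler_sumr.
by apply: eq_bigr => i _; rewrite coefZ scalerA.
Qed.

Lemma poly_opN T p x : poly_op (- p) T x = - poly_op p T x.
Proof. by rewrite -scaleN1r poly_opZ scaleN1r. Qed.

Lemma poly_opB T p q x : poly_op (p - q) T x = poly_op p T x - poly_op q T x.
Proof. by rewrite poly_opD poly_opN. Qed.

Lemma poly_opC T c x : poly_op c%:P T x = c *: x.
Proof.
by rewrite (@poly_opE _ _ 1) ?size_polyC_leq1// big_ord1 coefC.
Qed.

Lemma poly_opMX T p x : poly_op (p * 'X) T x = poly_op p T (T x).
Proof.
rewrite (@poly_opE _ (p * 'X) (size p).+1); last first.
  by rewrite (leq_trans (size_polyMleq _ _))// size_polyX addn2.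
rewrite big_ord_recl coefMX/= scale0r add0r.
by apply: eq_bigr => i _; rewrite coefMX -iterS iterSr.
Qed.

Lemma poly_opX T x : poly_op 'X T x = T x.
Proof. by rewrite -[X in poly_op X]mul1r poly_opMX poly_opC scale1r. Qed.

Section LinearT.
Variable T : H -> H.
Hypothesis lT : linear T.

Lemma poly_op_linear p : linear (poly_op p T).
Proof.
elim/poly_ind: p => [|p c IH] a x y.
  by rewrite -[0]/(0%:P) !poly_opC !scale0r scaler0 addr0.
rewrite !poly_opD !poly_opMX !poly_opC lT IH !scalerDr addrACA.
by rewrite !scalerA [c * a]mulrC.
Qed.

Lemma poly_opM p q x : poly_op (p * q) T x = poly_op p T (poly_op q T x).
Proof.
elim/poly_ind: q x => [|q c IH] x.
  have [_ _ _ p0] := linear_morphs (poly_op_linear p).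
  by rewrite mulr0 -[0]/(0%:P) !poly_opC !scale0r p0.
have [pD _ pZ _] := linear_morphs (poly_op_linear p).
rewrite mulrDr mulrA !poly_opD !poly_opMX pD IH; congr (_ + _).
by rewrite [p * _]mulrC mul_polyC poly_opZ poly_opC pZ.
Qed.

Lemma poly_op_comm p x : poly_op p T (T x) = T (poly_op p T x).
Proof. by rewrite -poly_opMX mulrC poly_opM poly_opX. Qed.

End LinearT.

Lemma poly_op_bounded T p : bounded_op T -> bounded_op (poly_op p T).
Proof.
move=> bT; elim/poly_ind: p => [|p c IH].
  rewrite (_ : poly_op _ _ = fun x => 0 *: x).
    exact: (bounded_opZ _ (bounded_op_id _)).
  by apply/funext => x; rewrite -[0]/(0%:P) poly_opC.
rewrite (_ : poly_op _ _ = fun x => (poly_op p T \o T) x + c *: x).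
  apply: bounded_opD; first exact: bounded_op_comp.
  exact: (bounded_opZ _ (bounded_op_id _)).
by apply/funext => x; rewrite poly_opD poly_opMX poly_opC.
Qed.

Lemma poly_op_adj T p x y : (forall x y, dot (T x) y = dot x (T y)) -> linear T ->
  dot (poly_op p T x) y = dot x (poly_op (map_poly Num.conj p) T y).
Proof.
move=> sT lT; elim/poly_ind: p x y => [|p c IH] x y.
  by rewrite rmorph0 -[0]/(0%:P) !poly_opC !scale0r linear0l linear0r.
rewrite rmorphD rmorphM/= map_polyX map_polyC/= !poly_opD !poly_opMX !poly_opC.
by rewrite dotDl dotDr dotZl dotZr IH sT poly_op_comm// conjCK.
Qed.

Lemma poly_op_intertwine A T S p x : linear A -> (forall x, A (T x) = S (A x)) ->
  A (poly_op p T x) = poly_op p S (A x).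
Proof.
move=> /linear_morphs[AD AB AZ A0] ATS; elim/poly_ind: p x => [|p c IH] x.
  by rewrite -[0]/(0%:P) !poly_opC !scale0r.
by rewrite !poly_opD !poly_opMX !poly_opC AD AZ IH ATS.
Qed.

End PolyOp.

(** * The norm of a polynomial in a positive operator *)

Section SpectralBound.
Variables (R : realType) (H : completeNormedModType R[i]).
Variables (dot : {dot H for Num.conj}).
Hypothesis Hdot : forall x : H, dot x x = `|x| ^+ 2.
Implicit Types (x y : H) (T S B : H -> H) (p q : {poly R[i]}).
Local Notation rdot := (rdot dot).
Local Notation psd := (psd dot).

(** The polynomial splits into linear factors, each of which is bounded below. *)
Lemma poly_op_bounded_below T p : linear T -> p != 0 ->
    (forall z, spectrum T z -> p.[z] != 0) ->
  exists2 c : R, 0 < c & forall x, c * rnorm x <= rnorm (poly_op p T x).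
Proof.
move=> lT p0 pn0; have [s ps] := closed_field_poly_normal p.
have lc0 : lead_coef p != 0 by rewrite lead_coef_eq0.
have nlc0 : 0 < rnorm (lead_coef p).
  by rewrite lt_def rnorm_ge0 andbT; apply: contra_neq lc0 => /rnorm0_eq0.
have : all (fun z => p.[z] == 0) s.
  apply/allP => z zs; rewrite ps hornerZ; have := root_prod_XsubC s z.
  by rewrite zs => /rootP ->; rewrite mulr0.
rewrite {}[in poly_op p]ps => {p0} ss.
suff [c c0 cT] : exists2 c : R, 0 < c & forall x,
    c * rnorm x <= rnorm (poly_op (\prod_(z <- s) ('X - z%:P)) T x).
  exists (rnorm (lead_coef p) * c); first exact: mulr_gt0.
  by move=> x; rewrite poly_opZ rnormZ -mulrA ler_wpM2l ?rnorm_ge0.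
elim: s ss => [_|z s IH /= /andP[/eqP pz /IH[c c0 cs]]].
  by exists 1 => // x; rewrite big_nil poly_opC scale1r mul1r.
have [|d d0 dT] := @resolvent_bounded_below _ _ T z; first by move/pn0; rewrite pz eqxx.
exists (d * c); first exact: mulr_gt0.
move=> x; rewrite big_cons poly_opM// poly_opB poly_opX poly_opC -mulrA.
by rewrite (le_trans _ (dT _))// ler_wpM2l// ltW.
Qed.

Definition form_sup B := sup [set rdot (B x) x | x in [set x : H | rnorm x = 1]].

(** The form of C = sup - B is positive and C <= sup, so Cauchy-Schwarz for this
form gives |C x|^2 <= sup * <C x, x>, which is small on a maximizing sequence. *)
Lemma form_sup_approx B x0 : x0 != 0 -> psd B -> bounded_op B ->
  [/\ 0 <= form_sup B, forall x, rdot (B x) x <= form_sup B * rnorm x ^+ 2 &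
   forall d : R, 0 < d ->
     exists2 x, rnorm x = 1 & rnorm (B x - (form_sup B)%:C *: x) <= d].
Proof.
move=> x0n0 pB /bounded_opP[lB [K K0 BK]].
have [BD BB BZ B0] := linear_morphs lB; have [_ sB B_ge0] := pB.
set A := [set rdot (B x) x | x in [set x : H | rnorm x = 1]].
have hA : has_sup A.
  split.
    by exists (rdot (B (((rnorm x0)^-1)%:C *: x0)) (((rnorm x0)^-1)%:C *: x0)),
      (((rnorm x0)^-1)%:C *: x0) => //=; exact: normalize.
  exists K => _ [x /= x1 <-].
  by rewrite (le_trans (rdot_bounded Hdot _ BK))// x1 expr1n mulr1.
have top_ub x : rnorm x = 1 -> rdot (B x) x <= form_sup B.
  by move=> x1; apply: (sup_upper_bound hA); exists x.
have top_ge0 : 0 <= form_sup B.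
  by have [[_ [x /= x1 _]] _] := hA; rewrite (le_trans (B_ge0 x))// top_ub.
have form_supP x : rdot (B x) x <= form_sup B * rnorm x ^+ 2.
  have [->|xn0] := eqVneq x 0.
    by rewrite B0 (rdot_rnorm Hdot) rnorm0 expr0n/= mulr0.
  rewrite {1 2}[x]normalizeK BZ rdotZl rdotZr mulrA -expr2 mulrC.
  by rewrite ler_wpM2r ?sqr_ge0// top_ub// normalize.
split => // d d0.
pose C x := (form_sup B)%:C *: x - B x.
have CE x : rdot (C x) x = form_sup B * rnorm x ^+ 2 - rdot (B x) x.
  by rewrite rdotBl rdotZl (rdot_rnorm Hdot).
have pC : psd C.
  split.
  - move=> a x y; rewrite /C lB !scalerDr !scalerN opprD addrACA !scalerA.
    by rewrite [_%:C * a]mulrC.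
  - by move=> x y; rewrite dotDl dotDr dotNl dotNr dotZl dotZr sB conj_real.
  - by move=> x; rewrite CE subr_ge0.
have C_top x : rnorm (C x) ^+ 2 <= form_sup B * rdot (C x) x.
  have [->|Cx0] := eqVneq (rnorm (C x)) 0.
    by rewrite expr0n/= mulr_ge0//; case: pC.
  have Cx2 : 0 < rnorm (C x) ^+ 2 by rewrite exprn_gt0// lt_def Cx0 rnorm_ge0.
  rewrite -(ler_pM2r Cx2) -expr2.
  have h := psd_cauchy_schwarz x (C x) pC.
  rewrite (dot_rnorm Hdot) rnormC ger0_norm ?(ltW Cx2)// in h.
  rewrite (le_trans h)// mulrAC ler_wpM2r//; first by case: pC.
  by rewrite CE gerBl.
have e0 : 0 < d ^+ 2 / (form_sup B + 1).
  by rewrite divr_gt0 ?exprn_gt0// ltr_wpDl.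
have [_ [x /= x1 <-] hx] := sup_adherent e0 hA.
exists x => //; rewrite -ler_sqr ?nnegrE ?rnorm_ge0 ?(ltW d0)// rnormBC.
rewrite (le_trans (C_top x))// CE x1 expr1n mulr1.
have top1 : 0 < form_sup B + 1 by rewrite ltr_wpDl.
have h2 : form_sup B - rdot (B x) x <= d ^+ 2 / (form_sup B + 1).
  by rewrite lerBlDl -lerBlDr ltW.
rewrite (le_trans (ler_wpM2l top_ge0 h2))// mulrA ler_pdivrMr// mulrC.
by rewrite ler_wpM2l ?sqr_ge0// lerDl.
Qed.

(** Otherwise p minus the supremum has no root in the spectrum, so that p(T) minus
the supremum is bounded below, contradicting the existence of approximate
eigenvectors.  If p is identically equal to the supremum, any point of the
spectrum will do, and the same argument for the polynomial X provides one. *)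
Lemma form_sup_spectrum T p x0 : x0 != 0 -> bounded_op T -> psd T ->
    psd (poly_op p T) ->
  exists2 z, spectrum T z & p.[z] = (form_sup (poly_op p T))%:C.
Proof.
move=> x0n0 bT pT pp.
have lT := bounded_op_lin bT.
have hit (q : {poly R[i]}) : psd (poly_op q T) ->
    q - (form_sup (poly_op q T))%:C%:P != 0 ->
    exists2 z, spectrum T z & q.[z] = (form_sup (poly_op q T))%:C.
  move=> pq qn0; apply: contrapT => nz.
  have [|c c0 cT] := poly_op_bounded_below lT qn0.
    move=> z sz; rewrite hornerD hornerN hornerC subr_eq0; apply/eqP => qz.
    by apply: nz; exists z.
  have [_ _ /(_ (c / 2))[|x x1]] := form_sup_approx x0n0 pq (poly_op_bounded q bT).
    by rewrite divr_gt0.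
  have := cT x; rewrite poly_opB poly_opC x1 mulr1; lra.
have [p0|pn0] := eqVneq (p - (form_sup (poly_op p T))%:C%:P) 0; last exact: hit.
have TX : poly_op 'X T = T by apply/funext => x; rewrite poly_opX.
have [||z sz _] := hit 'X.
- by rewrite TX.
- by rewrite polyXsubC_eq0.
exists z => //; apply/eqP; rewrite -subr_eq0.
by rewrite -[X in _ - X](hornerC _ z) -hornerN -hornerD p0 horner0.
Qed.

(** On the real spectrum the polynomial conj(q) * q takes the values |q|^2, and the
form of the corresponding operator is |q(T) x|^2. *)
Lemma poly_op_spectral_bound T q (e : R) : bounded_op T -> psd T -> 0 <= e ->
    (forall z, spectrum T z -> rnorm q.[z] <= e) ->
  bounded_by e (poly_op q T).
Proof.
move=> bT pT e0 qe x; have [lT sT T_ge0] := pT.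
have [->|xn0] := eqVneq x 0.
  by have [_ _ _ ->] := linear_morphs (poly_op_linear lT q); rewrite !rnorm0 mulr0.
pose qc := map_poly Num.conj q; pose p := qc * q.
have pE y z : dot (poly_op p T y) z = dot (poly_op q T y) (poly_op q T z).
  rewrite poly_opM// poly_op_adj// /qc -map_poly_comp map_poly_id// => c _ /=.
  by rewrite conjCK.
have pp : psd (poly_op p T).
  split; first exact: poly_op_linear.
  - by move=> y z; rewrite pE (dotC dot y) pE -(dotC dot).
  - by move=> y; rewrite /rdot pE (dot_rnorm Hdot) sqr_ge0.
have [z sz pz] := form_sup_spectrum xn0 bT pT pp.
have [/= _ form_supP _] := form_sup_approx xn0 pp (poly_op_bounded p bT).
have /bounded_opP[_ [M M0 TM]] := bT.
have [r _ zr] := psd_spectrum Hdot M0 pT TM sz.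
have zc : Num.conj z = z by rewrite zr conj_real.
have le_top : form_sup (poly_op p T) <= e ^+ 2.
  have -> : form_sup (poly_op p T) = rnorm q.[z] ^+ 2.
    apply: complexI; rewrite -pz hornerM mulrC -mul_conj_rnorm; congr (_ * _).
    by rewrite /qc -{1}zc horner_map.
  by rewrite ler_sqr ?nnegrE ?rnorm_ge0 ?qe.
rewrite -ler_sqr ?nnegrE ?mulr_ge0 ?rnorm_ge0// exprMn.
have -> : rnorm (poly_op q T x) ^+ 2 = rdot (poly_op p T x) x.
  by rewrite /rdot pE (dot_rnorm Hdot).
by rewrite (le_trans (form_supP x))// ler_wpM2r ?sqr_ge0.
Qed.

End SpectralBound.

(** * Polynomial approximation *)

Section Weierstrass.
Variable R : realType.
Implicit Types (x y M e : R) (f g : R -> R) (h : nat -> R).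

(** On [0, M] this amounts to uniform continuity.  The quadratic term is the one
that Bernstein's argument integrates against the binomial distribution, whose
variance is explicit. *)
Definition quad_modulus M f := forall e, 0 < e -> exists2 K, 0 <= K &
  forall x y, 0 <= x <= M -> 0 <= y <= M -> `|f x - f y| <= e + K * (x - y) ^+ 2.

(** The expectation of h at the number of successes in n Bernoulli trials of
parameter X, by conditioning on the first trial.  The recursion replaces
binomial coefficients and makes monotonicity and moments plain inductions. *)
Fixpoint bernstein n h : {poly R} :=
  if n is m.+1 then (1 - 'X) * bernstein m h + 'X * bernstein m (h \o S)
  else (h 0%N)%:P.

Lemma bernsteinS n h x : (bernstein n.+1 h).[x] =
  (1 - x) * (bernstein n h).[x] + x * (bernstein n (h \o S)).[x].
Proof. by rewrite /= !hornerE. Qed.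

Lemma bernstein_le n h h' x : 0 <= x <= 1 ->
    (forall k, (k <= n)%N -> h k <= h' k) ->
  (bernstein n h).[x] <= (bernstein n h').[x].
Proof.
move=> /andP[x0 x1]; elim: n h h' => [|n IH] h h' hh.
  by rewrite /= !hornerC hh.
by rewrite !bernsteinS lerD// ler_wpM2l ?subr_ge0// IH// => k kn;
  apply: hh => //; exact: leqW.
Qed.

(** The second moment of the binomial distribution about c, for a general c since
the recursion shifts it. *)
Lemma bernstein_moment n (a b c x : R) :
  (bernstein n (fun k => a + b * (k%:R - c) ^+ 2)).[x] =
  a + b * (n%:R * (x * (1 - x)) + (n%:R * x - c) ^+ 2).
Proof.
elim: n c => [|n IH] c; first by rewrite /= hornerC; ring.
rewrite bernsteinS IH.
rewrite (_ : _ \o S = fun k => a + b * (k%:R - (c - 1)) ^+ 2); last first.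
  by apply/funext => k /=; rewrite -natr1; ring.
rewrite IH -natr1; ring.
Qed.

(** The Bernstein polynomial is squeezed between the expectations of the two
parabolas f x -+ (e / 2 + K (k / n - x)^2), and the variance of k / n is at
most 1 / n. *)
Lemma weierstrass01 f e : quad_modulus 1 f -> 0 < e ->
  exists p : {poly R}, forall x, 0 <= x <= 1 -> `|p.[x] - f x| <= e.
Proof.
move=> fm e0; have e2 : 0 < e / 2 by rewrite divr_gt0.
have [K K0 fK] := fm _ e2.
have [N Ne] : exists N : nat, K / N.+1%:R <= e / 2.
  have K1 : 0 < K + 1 by rewrite ltr_wpDl.
  have ab : 0 < (e / 2) / (K + 1) by rewrite divr_gt0.
  have [N _ /(_ N (leqnn _))/= hN] := near_infty_natSinv_lt (PosNum ab).
  exists N; rewrite ltr_pdivlMr// mulrC in hN; apply: le_trans (ltW hN).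
  by rewrite ler_wpM2r ?invr_ge0// lerDl.
pose n := N.+1; have n0 : n%:R != 0 :> R by rewrite pnatr_eq0.
exists (bernstein n (fun k => f (k%:R / n%:R))) => x x01.
have fn k : (k <= n)%N -> `|f (k%:R / n%:R) - f x|
    <= e / 2 + K / n%:R ^+ 2 * (k%:R - n%:R * x) ^+ 2.
  move=> kn; have -> : K / n%:R ^+ 2 * (k%:R - n%:R * x) ^+ 2
    = K * (k%:R / n%:R - x) ^+ 2 by field.
  apply: fK => //; rewrite divr_ge0//= ler_pdivrMr ?ltr0n// mul1r ler_nat//.
have var : K / n%:R ^+ 2
    * (n%:R * (x * (1 - x)) + (n%:R * x - n%:R * x) ^+ 2) <= e / 2.
  apply: le_trans Ne; rewrite -/n.
  have -> : K / n%:R ^+ 2 * (n%:R * (x * (1 - x)) + (n%:R * x - n%:R * x) ^+ 2)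
     = K / n%:R * (x * (1 - x)) by field.
  by rewrite ler_piMr ?divr_ge0//; have /andP[] := x01; nra.
rewrite ler_norml; apply/andP; split.
- have : (bernstein n (fun k => (f x - e / 2)
      + - (K / n%:R ^+ 2) * (k%:R - n%:R * x) ^+ 2)).[x] <= (bernstein n (fun k => f (k%:R / n%:R))).[x].
    apply: bernstein_le => // k /fn; rewrite ler_norml => /andP[+ _].
    by set u := K / _ * _; rewrite mulNr -/u; lra.
  rewrite bernstein_moment; move: var; set u := n%:R * _ + _; rewrite mulNr.
  by set v := K / _ * u; lra.
- have : (bernstein n (fun k => f (k%:R / n%:R))).[x] <=
     (bernstein n (fun k => (f x + e / 2)
      + (K / n%:R ^+ 2) * (k%:R - n%:R * x) ^+ 2)).[x].
    apply: bernstein_le => // k /fn; rewrite ler_norml => /andP[_ +].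
    by set u := K / _ * _; lra.
  rewrite bernstein_moment; move: var; set u := n%:R * _ + _.
  by set v := K / _ * u; lra.
Qed.

Lemma weierstrass M f e : 0 < M -> quad_modulus M f -> 0 < e ->
  exists p : {poly R}, forall x, 0 <= x <= M -> `|p.[x] - f x| <= e.
Proof.
move=> M0 fm e0; have Mn0 : M != 0 by rewrite gt_eqF.
have [|p pf] := @weierstrass01 (fun x => f (M * x)) e _ e0.
  move=> d d0; have [K K0 fK] := fm d d0.
  exists (K * M ^+ 2); first by rewrite mulr_ge0 ?sqr_ge0.
  have MM z : 0 <= z <= 1 -> 0 <= M * z <= M.
    by move=> /andP[z0 z1]; rewrite mulr_ge0 ?(ltW M0)//= ler_piMr// ltW.
  move=> x y /MM hx /MM hy.
  by rewrite (le_trans (fK _ _ hx hy))// -mulrBr exprMn mulrA.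
exists (p \Po (M^-1 *: 'X)) => x /andP[x0 xM].
rewrite horner_comp hornerZ hornerX -{2}(mulVKf Mn0 x) ; apply: pf.
by rewrite mulr_ge0 ?invr_ge0 ?(ltW M0)//= mulrC ler_pdivrMr// mul1r.
Qed.

Lemma quad_modulus_bounded M f : 0 <= M -> quad_modulus M f ->
  exists2 B, 0 <= B & forall x, 0 <= x <= M -> `|f x| <= B.
Proof.
move=> M0 /(_ 1 ltr01)[K K0 fK].
exists (1 + K * M ^+ 2 + `|f 0|).
  by rewrite !addr_ge0// mulr_ge0// sqr_ge0.
move=> x /andP[x0 xM]; rewrite -[f x](subrK (f 0)).
rewrite (le_trans (ler_normD _ _))// lerD2r.
rewrite (le_trans (fK _ _ _ _)) ?x0 ?lexx// lerD2l ler_wpM2l// subr0.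
by rewrite ler_sqr.
Qed.

Lemma quad_modulus_cst M (c : R) : quad_modulus M (fun=> c).
Proof. by move=> e e0; exists 0 => // x y _ _; rewrite subrr normr0 mul0r addr0 ltW. Qed.

Lemma quad_modulusM M f g : 0 <= M -> quad_modulus M f -> quad_modulus M g ->
  quad_modulus M (fun x => f x * g x).
Proof.
move=> M0 fm gm e e0.
have [B B0 fB] := quad_modulus_bounded M0 fm.
have [C C0 gC] := quad_modulus_bounded M0 gm.
pose D := B + C + 1; have D0 : 0 < D by rewrite ltr_wpDl// addr_ge0.
have d0 : 0 < e / (2 * D) by rewrite divr_gt0// mulr_gt0.
have [K K0 fK] := fm _ d0; have [L L0 gL] := gm _ d0.
exists (D * (K + L)); first by rewrite mulr_ge0 ?addr_ge0// ltW.
move=> x y hx hy.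
have -> : f x * g x - f y * g y = f x * (g x - g y) + g y * (f x - f y) by ring.
rewrite (le_trans (ler_normD _ _))// !normrM.
have h1 : `|f x| * `|g x - g y| <= D * (e / (2 * D) + L * (x - y) ^+ 2).
  by rewrite ler_pM// ?gL// (le_trans (fB _ hx))// /D -addrA lerDl addr_ge0.
have h2 : `|g y| * `|f x - f y| <= D * (e / (2 * D) + K * (x - y) ^+ 2).
  rewrite ler_pM// ?fK// (le_trans (gC _ hy))// /D addrAC lerDr addr_ge0//.
rewrite (le_trans (lerD h1 h2))// le_eqVlt; apply/orP; left; apply/eqP.
by field; rewrite gt_eqF.
Qed.

Lemma quad_modulus_inv M f (c : R) : 0 < c -> quad_modulus M f ->
    (forall x, 0 <= x <= M -> 0 <= f x) ->
  quad_modulus M (fun x => (f x + c)^-1).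
Proof.
move=> c0 fm f0 e e0; have d0 : 0 < e * c ^+ 2 by rewrite mulr_gt0// exprn_gt0.
have [K K0 fK] := fm _ d0.
exists (K / c ^+ 2); first by rewrite divr_ge0// sqr_ge0.
move=> x y hx hy; have := fK x y hx hy; have := f0 x hx; have := f0 y hy.
set u := f x; set v := f y; set w := (x - y) ^+ 2 => v0 u0 uv.
have uc : 0 < u + c by rewrite ltr_wpDl.
have vc : 0 < v + c by rewrite ltr_wpDl.
have -> : (u + c)^-1 - (v + c)^-1 = (v - u) / ((u + c) * (v + c)).
  by field; rewrite !gt_eqF.
rewrite normrM distrC normfV (gtr0_norm (mulr_gt0 uc vc)).
rewrite ler_pdivrMr ?mulr_gt0//.
have -> : e + K / c ^+ 2 * w = (e * c ^+ 2 + K * w) / c ^+ 2.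
  by field; rewrite gt_eqF.
rewrite (le_trans uv)// -mulrA ler_peMr//.
  by rewrite (le_trans _ uv).
rewrite mulrC ler_pdivlMr ?exprn_gt0// mul1r expr2.
by rewrite ler_pM ?(ltW c0)// lerDr.
Qed.

(** Subadditivity: both y / x and (x - y) / x lie in [0, 1], where z <= z^s, and
they add up to 1. *)
Lemma powR_subadd (s x y : R) : 0 <= s <= 1 -> 0 <= y <= x ->
  x `^ s - y `^ s <= (x - y) `^ s.
Proof.
move=> /andP[s0 s1] /andP[y0 yx]; have [x0|x0] := eqVneq x 0.
  have -> : y = x by apply/eqP; rewrite eq_le yx x0 y0.
  by rewrite subrr powR_ge0.
have xgt0 : 0 < x by rewrite lt_def x0 (le_trans y0).
have sub1 z : 0 <= z <= 1 -> z <= z `^ s.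
  move=> /andP[z0 z1]; have [->|zn0] := eqVneq z 0; first exact: powR_ge0.
  by rewrite ger1_powR// lt_def zn0 z0.
have h z : 0 <= z <= x -> z / x * x `^ s <= z `^ s.
  move=> /andP[z0 zx]; rewrite -{2}(divfK x0 z) powRM ?divr_ge0// ?(ltW xgt0)//.
  rewrite ler_wpM2r ?powR_ge0// sub1// divr_ge0 ?(ltW xgt0)//=.
  by rewrite ler_pdivrMr// mul1r.
have h1 : y / x * x `^ s <= y `^ s by apply: h; rewrite y0.
have h2 : (x - y) / x * x `^ s <= (x - y) `^ s.
  by apply: h; rewrite subr_ge0 yx gerBl.
rewrite lerBlDl (le_trans _ (lerD h1 h2))// -mulrDl -mulrDl addrC subrK.
by rewrite divff// mul1r.
Qed.

(** From |x^s - y^s| <= |x - y|^s: this is at most e for |x - y| <= d = e^(1/s), and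
otherwise at most M^s <= (M^s / d^2) (x - y)^2. *)
Lemma quad_modulus_powR1 M (s : R) : 0 <= M -> 0 <= s <= 1 ->
  quad_modulus M (fun x => x `^ s).
Proof.
move=> M0 s01; have /andP[s0 s1] := s01.
have [->|sn0] := eqVneq s 0.
  rewrite (_ : (fun=> _) = fun=> 1); last by apply/funext => x; rewrite powRr0.
  exact: quad_modulus_cst.
move=> e e0; pose d := e `^ s^-1; have d0 : 0 < d by exact: powR_gt0.
have de : d `^ s = e by rewrite -powRrM mulVf// powRr1// ltW.
exists (M `^ s / d ^+ 2); first by rewrite divr_ge0 ?powR_ge0 ?sqr_ge0.
have main x y : 0 <= y <= x -> x <= M ->
    `|x `^ s - y `^ s| <= e + M `^ s / d ^+ 2 * (x - y) ^+ 2.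
  move=> /andP[y0 yx] xM; rewrite ger0_norm; last first.
    by rewrite subr_ge0 ge0_ler_powR// nnegrE (le_trans y0).
  rewrite (le_trans (powR_subadd s01 _)) ?y0//.
  have xy0 : 0 <= x - y by rewrite subr_ge0.
  have [xyd|dxy] := leP (x - y) d.
    apply: ler_wpDr; last by rewrite -de ge0_ler_powR// nnegrE// ltW.
    by rewrite mulr_ge0 ?sqr_ge0// divr_ge0 ?powR_ge0 ?sqr_ge0.
  rewrite ler_wpDl ?(ltW e0)// (@le_trans _ _ (M `^ s))//.
    by rewrite ge0_ler_powR// ?nnegrE// lerBlDr (le_trans xM)// lerDl.
  rewrite mulrAC ler_pdivlMr ?exprn_gt0// ler_wpM2l ?powR_ge0//.
  by rewrite ler_sqr ?nnegrE ?(ltW d0)// ltW.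
move=> x y /andP[x0 xM] /andP[y0 yM]; have [xy|/ltW yx] := leP y x.
  by apply: main; rewrite ?y0.
by rewrite distrC -[(x - y)]opprB sqrrN; apply: main; rewrite ?x0.
Qed.

Lemma quad_modulus_eq M f g : (forall x, 0 <= x <= M -> f x = g x) ->
  quad_modulus M f -> quad_modulus M g.
Proof.
move=> fg fm e /fm[K K0 fK]; exists K => // x y hx hy.
by rewrite -!fg// fK.
Qed.

(** Exponents above 1 are lowered by r^s = r * r^(s - 1). *)
Lemma quad_modulus_powR M (s : R) : 0 <= M -> 0 <= s ->
  quad_modulus M (fun x => x `^ s).
Proof.
move=> M0 s0; have [n] : exists n : nat, s <= n%:R + 1.
  by exists (Num.truncn s); rewrite natr1 ltW// truncnS_gt.
elim: n s s0 => [|n IH] s s0.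
  by rewrite add0r => s1; apply: quad_modulus_powR1; rewrite ?s0.
move=> sn; have [s1|s1] := leP s 1; first by apply: quad_modulus_powR1; rewrite ?s0.
have m1 : quad_modulus M (fun x => x `^ 1).
  by apply: quad_modulus_powR1; rewrite ?ler01 ?lexx.
have m2 : quad_modulus M (fun x => x `^ (s - 1)).
  by apply: IH; [rewrite subr_ge0 ltW | rewrite lerBlDr natr1].
apply: quad_modulus_eq (quad_modulusM M0 m1 m2) => x /andP[x0 _].
by rewrite powRr1// mulr_powRB1// (lt_trans ltr01).
Qed.

End Weierstrass.

(** * Continuous functional calculus of a positive operator *)

Section Calculus.
Variables (R : realType) (H : completeNormedModType R[i]).
Variables (dot : {dot H for Num.conj}).
Hypothesis Hdot : forall x : H, dot x x = `|x| ^+ 2.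
Implicit Types (x y : H) (T S : H -> H) (p q : {poly R[i]}) (f g : R -> R).
Local Notation rdot := (rdot dot).
Local Notation psd := (psd dot).

(** Extends a real function to the complex numbers in the way real powers of
operators are set up; only its values on the real axis matter. *)
Definition cfun f : R[i] -> R[i] := fun z => (f (complex.Re z))%:C.

Definition approx T f S (e : R) (p : {poly R[i]}) :=
  (forall z, spectrum T z -> rnorm (p.[z] - cfun f z) <= e) /\
  bounded_by e (fun x => poly_op p T x - S x).

(** A sequence-free form of the functional calculus for real functions: one
polynomial for each accuracy e. *)
Definition calculus T f S :=
  bounded_op S /\ forall e, 0 < e -> exists p, approx T f S e p.

Lemma bounded_opB T S : bounded_op T -> bounded_op S ->
  bounded_op (fun x => T x - S x).
Proof.
move=> bT bS; have := bounded_opD bT (bounded_opZ (-1) bS).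
by congr bounded_op; apply/funext => x; rewrite scaleN1r.
Qed.

Lemma calculusP T f S : bounded_op T -> is_cfc T (cfun f) S <-> calculus T f S.
Proof.
move=> bT; split=> [[bS [p [pf pS]]]|[bS TS]]; split => //.
  move=> e e0; have [N _ pN] := pf _ e0.
  have /cvgrPdist_lt/(_ _ e0)[N' _ pN'] := pS.
  pose n := maxn N N'; exists (p n); split.
    move=> z sz; rewrite -lecR -rnormE; apply: pN => //=; exact: leq_maxl.
  have := pN' n (leq_maxr _ _); rewrite sub0r normrN => /ltW h.
  apply: bounded_by_le (opnorm_bound _); last first.
    exact: bounded_opB (poly_op_bounded _ bT) bS.
  exact: le_trans (ler_norm _) h.
have /choice[p pS] (n : nat) : exists p, approx T f S n.+1%:R^-1 p.
  by apply: TS; rewrite invr_gt0.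
have small (e : R) : 0 < e -> \forall n \near \oo, n.+1%:R^-1 < e.
  by move=> e0; exact: (near_infty_natSinv_lt (PosNum e0)).
exists p; split.
  move=> e e0; apply: filterS (small e e0) => n en z sz.
  by rewrite rnormE lecR (le_trans ((pS n).1 z sz))// ltW.
apply/cvgrPdist_lt => e e0; apply: filterS (small e e0) => n en.
rewrite sub0r normrN ger0_norm ?opnorm_ge0// (le_lt_trans _ en)//.
by apply: opnorm_le; [rewrite invr_ge0|exact: (pS n).2].
Qed.

Lemma eq0_harmonic x (C : R) : (forall n, rnorm x <= C * n.+1%:R^-1) -> x = 0.
Proof.
move=> h; apply/rnorm0_eq0/eqP; rewrite eq_le rnorm_ge0 andbT -oppr_ge0.
by apply: (@ge0_harmonic _ _ C) => n; rewrite addrC subr_ge0.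
Qed.

Lemma horner_bounded p (M : R) : 0 <= M ->
  exists2 B : R, 0 <= B & forall z, rnorm z <= M -> rnorm p.[z] <= B.
Proof.
move=> M0; elim/poly_ind: p => [|p c [B B0 pB]].
  by exists 0 => // z _; rewrite horner0 rnorm0.
exists (B * M + rnorm c); first by rewrite addr_ge0 ?rnorm_ge0// mulr_ge0.
move=> z zM; rewrite !hornerE (le_trans (rnormD _ _))// lerD2r rnormM.
by rewrite ler_pM ?rnorm_ge0// pB.
Qed.

Section PsdT.
Variables (T : H -> H) (M : R).
Hypotheses (M0 : 0 <= M) (pT : psd T) (TM : bounded_by M T).

Let lT : linear T. Proof. by case: pT. Qed.
Let bT : bounded_op T. Proof. by apply/bounded_opP; split => //; exists M. Qed.

Lemma spectrum_cfun z : spectrum T z ->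
  exists2 r : R, 0 <= r <= M & z = r%:C /\ forall f, cfun f z = (f r)%:C.
Proof.
by move=> /(psd_spectrum Hdot M0 pT TM)[r rM ->]; exists r.
Qed.

Lemma calculus_poly (p : {poly R}) :
  calculus T (fun r => p.[r]) (poly_op (map_poly (real_complex R) p) T).
Proof.
split; first exact: poly_op_bounded.
move=> e e0; exists (map_poly (real_complex R) p); split.
  move=> z /spectrum_cfun[r _ [-> ->]].
  by rewrite (horner_map (real_complex R)) subrr rnorm0 ltW.
by move=> x; rewrite subrr rnorm0 mulr_ge0 ?rnorm_ge0 ?ltW.
Qed.

Lemma calculus_eq f g S : (forall r, 0 <= r <= M -> f r = g r) ->
  calculus T f S -> calculus T g S.
Proof.
move=> fg [bS TS]; split => // e /TS[p [pf pS]]; exists p; split => // z sz.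
have [r rM [_ fr]] := spectrum_cfun sz.
by rewrite fr -fg// -fr pf.
Qed.

Lemma calculus1 : calculus T (fun=> 1) id.
Proof.
have := calculus_poly 1; congr calculus.
  by apply/funext => r; rewrite hornerC.
by apply/funext => x; rewrite rmorph1 poly_opC scale1r.
Qed.

Lemma calculusX : calculus T (fun r => r) T.
Proof.
have := calculus_poly 'X; congr calculus.
  by apply/funext => r; rewrite hornerX.
by apply/funext => x; rewrite map_polyX poly_opX.
Qed.

Lemma calculus_fun_bounded f S : calculus T f S ->
  exists2 B : R, 0 <= B & forall z, spectrum T z -> rnorm (cfun f z) <= B.
Proof.
move=> [_ /(_ 1 ltr01)[p [pf _]]].
have [B B0 pB] := horner_bounded p M0.
exists (1 + B) => [|z sz]; first exact: addr_ge0.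
rewrite (le_trans (rnorm_split _ p.[z]))// rnormBC lerD ?pf// pB//.
have [r /andP[r0 rM] [-> _]] := spectrum_cfun sz.
by rewrite rnormC ger0_norm.
Qed.

(** The spectral bound passes to the limit. *)
Lemma calculus_bound f S (c : R) : 0 <= c ->
    (forall z, spectrum T z -> rnorm (cfun f z) <= c) -> calculus T f S ->
  bounded_by c S.
Proof.
move=> c0 fc [_ TS] x; apply/ler_addgt0Pr => d d0.
pose K := 2 * rnorm x + 1; have K0 : 0 < K by rewrite ltr_wpDl// mulr_ge0 ?rnorm_ge0.
have e0 : 0 < d / K by rewrite divr_gt0.
have [p [pf pS]] := TS _ e0; set e := d / K in e0 pf pS.
have pT_bound : bounded_by (c + e) (poly_op p T).
  apply: (poly_op_spectral_bound Hdot) => //; first by rewrite addr_ge0// ltW.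
  by move=> z sz; rewrite (le_trans (rnorm_split _ (cfun f z)))// [leLHS]addrC lerD ?fc ?pf.
have h1 := pT_bound x; have := pS x; rewrite rnormBC => h2.
rewrite (le_trans (rnorm_split _ (poly_op p T x)))//.
rewrite (le_trans (lerD h2 h1))//.
have -> : e * rnorm x + (c + e) * rnorm x = c * rnorm x + e * (2 * rnorm x) by ring.
rewrite lerD2l (@le_trans _ _ (e * K))//; last by rewrite /e divfK// gt_eqF.
by rewrite ler_wpM2l ?(ltW e0)// /K lerDl.
Qed.

Lemma calculus_lin (a b : R) f g S S' : calculus T f S -> calculus T g S' ->
  calculus T (fun r => a * f r + b * g r) (fun x => a%:C *: S x + b%:C *: S' x).
Proof.
move=> [bS TS] [bS' TS']; split; first by apply: bounded_opD; exact: bounded_opZ.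
move=> e e0; pose K := `|a| + `|b| + 1; have K0 : 0 < K by rewrite ltr_wpDl.
have d0 : 0 < e / K by rewrite divr_gt0.
have eK (u v : R) : 0 <= u -> 0 <= v -> u <= e / K -> v <= e / K ->
    `|a| * u + `|b| * v <= e.
  move=> u0 v0 ud vd; apply: (@le_trans _ _ (K * (e / K))); last first.
    by rewrite mulrC divfK// gt_eqF.
  rewrite /K !mulrDl ler_wpDr ?mul1r ?(ltW d0)//.
  by rewrite lerD// ler_wpM2l.
have [p [pf pS]] := TS _ d0; have [q [qg qS']] := TS' _ d0.
set d := e / K in d0 eK pf pS qg qS'; clearbody d.
exists (a%:C *: p + b%:C *: q); split.
  move=> z sz; rewrite !hornerE.
  have -> : a%:C * p.[z] + b%:C * q.[z] - cfun (fun r => a * f r + b * g r) z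
     = a%:C * (p.[z] - cfun f z) + b%:C * (q.[z] - cfun g z).
    by rewrite /cfun rmorphD !rmorphM/=; ring.
  by rewrite (le_trans (rnormD _ _))// !rnormM !rnormC eK ?rnorm_ge0 ?pf ?qg//.
move=> x; rewrite poly_opD !poly_opZ opprD addrACA -!scalerBr.
rewrite (le_trans (rnormD _ _))// !rnormZr.
rewrite (le_trans (lerD (ler_wpM2l _ (pS x)) (ler_wpM2l _ (qS' x))))//.
by rewrite !mulrA -mulrDl ler_wpM2r ?rnorm_ge0// eK// ltW.
Qed.

Lemma calculusB f g S S' : calculus T f S -> calculus T g S' ->
  calculus T (fun r => f r - g r) (fun x => S x - S' x).
Proof.
move=> Sf Sg; have := calculus_lin 1 (-1) Sf Sg; congr calculus.
  by apply/funext => r; rewrite mul1r mulN1r.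
by apply/funext => x; rewrite rmorphN1 scale1r scaleN1r.
Qed.

Lemma calculusM f g S S' : calculus T f S -> calculus T g S' ->
  calculus T (fun r => f r * g r) (S \o S').
Proof.
move=> cS cS'; have [bS TS] := cS; have [bS' TS'] := cS'.
split; first exact: bounded_op_comp.
have [B B0 fB] := calculus_fun_bounded cS.
have [C C0 gC] := calculus_fun_bounded cS'.
move=> e e0; pose K := B + C + 1.
have K0 : 0 < K by rewrite ltr_wpDl// addr_ge0.
pose d := Num.min 1 (e / K); have d0 : 0 < d by rewrite lt_min ltr01 divr_gt0.
have d1 : d <= 1 by rewrite ge_min lexx.
have dK : (B + 1) * d + C * d <= e.
  rewrite -mulrDl addrAC -/K mulrC -ler_pdivlMr// /d ge_min lexx orbT//.
have [p [pf pS]] := TS _ d0; have [q [qg qS']] := TS' _ d0.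
have pB z : spectrum T z -> rnorm p.[z] <= B + 1.
  move=> sz; rewrite (le_trans (rnorm_split _ (cfun f z)))// [leLHS]addrC lerD ?fB//.
  by rewrite (le_trans (pf z sz)).
exists (p * q); split.
  move=> z sz; rewrite hornerM.
  have -> : p.[z] * q.[z] - cfun (fun r => f r * g r) z
     = p.[z] * (q.[z] - cfun g z) + cfun g z * (p.[z] - cfun f z).
    by rewrite /cfun !rmorphM/=; ring.
  rewrite (le_trans (rnormD _ _))// !rnormM (le_trans _ dK)//.
  by rewrite lerD// ler_pM ?rnorm_ge0 ?pB ?qg ?gC ?pf//.
have pT_bound : bounded_by (B + 1) (poly_op p T).
  by apply: (poly_op_spectral_bound Hdot) => //; rewrite addr_ge0.
have S'C := calculus_bound C0 gC cS'.
have [_ pTB _ _] := linear_morphs (poly_op_linear lT p).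
move=> x; rewrite poly_opM//=.
have -> : poly_op p T (poly_op q T x) - S (S' x)
   = poly_op p T (poly_op q T x - S' x) + (poly_op p T (S' x) - S (S' x)).
  by rewrite pTB addrA subrK.
rewrite (le_trans (rnormD _ _))//.
rewrite (le_trans (lerD (pT_bound _) (pS _)))//.
have h1 := qS' x; have h2 := S'C x.
rewrite (@le_trans _ _ ((B + 1) * (d * rnorm x) + d * (C * rnorm x)))//.
  by rewrite lerD// ler_wpM2l// ?addr_ge0// ltW.
have -> : (B + 1) * (d * rnorm x) + d * (C * rnorm x) = ((B + 1) * d + C * d) * rnorm x by ring.
by rewrite ler_wpM2r ?rnorm_ge0.
Qed.

Lemma calculus_inj f S S' : calculus T f S -> calculus T f S' -> S = S'.
Proof.
move=> Sf Sf'; have := calculusB Sf Sf' => h; apply/funext => x.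
apply/eqP; rewrite -subr_eq0; apply/eqP/rnorm0_eq0/eqP; rewrite eq_le rnorm_ge0 andbT.
rewrite -[leRHS](mul0r (rnorm x)); apply: calculus_bound h _ => // z _.
by rewrite /cfun subrr rnorm0.
Qed.

(** If the polynomial p approximates the real function f on the real spectrum, so
does the polynomial with conjugate coefficients, which gives the adjoint of
p(T). *)
Lemma calculus_sym f S : calculus T f S -> forall x y, dot (S x) y = dot x (S y).
Proof.
move=> [bS TS] x y; apply/eqP; rewrite -subr_eq0; apply/eqP.
have [_ sT _] := pT.
suff h n : rnorm (dot (S x) y - dot x (S y)) <= (4 * (rnorm x * rnorm y)) * n.+1%:R^-1.
  apply: rnorm0_eq0; apply/eqP; rewrite eq_le rnorm_ge0 andbT -oppr_ge0.
  by apply: (@ge0_harmonic _ _ (4 * (rnorm x * rnorm y))) => n; rewrite addrC subr_ge0 h.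
have d0 : 0 < n.+1%:R^-1 :> R by rewrite invr_gt0.
have [p [pf pS]] := TS _ d0; set d := n.+1%:R^-1 in d0 pf pS *.
pose pc := map_poly Num.conj p.
have pcp : bounded_by (d + d) (poly_op (pc - p) T).
  apply: (poly_op_spectral_bound Hdot) => //; first by rewrite addr_ge0 ?ltW.
  move=> z sz; have [r _ [zr fr]] := spectrum_cfun sz.
  have zc : Num.conj z = z by rewrite zr conj_real.
  rewrite !hornerE (le_trans (rnorm_dist _ (cfun f z) _))// lerD//; last first.
    by rewrite rnormBC pf//.
  have -> : pc.[z] - cfun f z = Num.conj (p.[z] - cfun f z).
    by rewrite rmorphB/= fr conj_real /pc -{1}zc horner_map.
  by rewrite rnorm_conj pf//.
have -> : dot (S x) y - dot x (S y) = - dot (poly_op p T x - S x) y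
   + dot x (poly_op (pc - p) T y) + dot x (poly_op p T y - S y).
  rewrite poly_opB dotDl !dotDr !dotNl !dotNr -poly_op_adj//; ring.
rewrite (le_trans (rnormD _ _))//.
rewrite (le_trans (lerD (rnormD _ _) (cauchy_schwarz Hdot _ _)))// rnormN.
rewrite (le_trans (lerD (lerD (cauchy_schwarz Hdot _ _) (cauchy_schwarz Hdot _ _)) (lexx _)))//.
have h1 := ler_wpM2r (rnorm_ge0 y) (pS x).
have h2 := ler_wpM2l (rnorm_ge0 x) (pcp y).
have h3 := ler_wpM2l (rnorm_ge0 x) (pS y).
rewrite (le_trans (lerD (lerD h1 h2) h3))// le_eqVlt; apply/orP; left.
by apply/eqP; ring.
Qed.

(** If f takes its values in [0, B] then |f - B / 2| <= B / 2, hence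
||f(T) - B / 2|| <= B / 2 and <f(T) x, x> >= 0. *)
Lemma calculus_psd f S : (forall r, 0 <= r <= M -> 0 <= f r) ->
  calculus T f S -> psd S.
Proof.
move=> f0 Sf; split; first exact: bounded_op_lin Sf.1.
  exact: calculus_sym Sf.
move=> x; have [B B0 fB] := calculus_fun_bounded Sf.
have h := calculus_lin 1 (- (B / 2)) Sf calculus1.
have B20 : 0 <= B / 2 by rewrite divr_ge0.
have : rnorm (1%:C *: S x + (- (B / 2))%:C *: x) <= B / 2 * rnorm x.
  apply: calculus_bound B20 _ h _ => z sz.
  have [r rM [_ fr]] := spectrum_cfun sz.
  have := fB z sz; rewrite !fr !rnormC ger0_norm ?f0// => frB.
  have := f0 r rM; rewrite ler_norml; set u := f r in frB * => u0.
  by apply/andP; split; lra.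
rewrite rmorph1 scale1r rmorphN/= scaleNr => Sx.
have := rdot_le Hdot (- (S x - (B / 2)%:C *: x)) x.
rewrite rnormN rdotNl rdotBl rdotZl (rdot_rnorm Hdot) => h1.
have h2 : rnorm (S x - (B / 2)%:C *: x) * rnorm x <= B / 2 * rnorm x ^+ 2.
  by rewrite expr2 mulrA ler_wpM2r ?rnorm_ge0.
by move: (le_trans h1 h2); set u := B / 2 * _; lra.
Qed.

Lemma calculus_le f g S S' x : (forall r, 0 <= r <= M -> f r <= g r) ->
  calculus T f S -> calculus T g S' -> rdot (S x) x <= rdot (S' x) x.
Proof.
move=> fg Sf Sg; rewrite -subr_ge0 -rdotBl.
have [|_ _] := calculus_psd _ (calculusB Sg Sf); last exact.
by move=> r rM; rewrite subr_ge0 fg.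
Qed.

Lemma calculus_exists f : 0 < M -> quad_modulus M f -> exists S, calculus T f S.
Proof.
move=> M_gt0 fM; pose d (n : nat) : R := n.+1%:R^-1.
have d_gt0 n : 0 < d n by rewrite invr_gt0.
have /choice[p pf] (n : nat) : exists p : {poly R},
    forall r, 0 <= r <= M -> `|p.[r] - f r| <= d n by exact: weierstrass.
pose P n := map_poly (real_complex R) (p n).
have Pf n z : spectrum T z -> rnorm ((P n).[z] - cfun f z) <= d n.
  move=> /spectrum_cfun[r rM [-> ->]].
  by rewrite (horner_map (real_complex R)) -rmorphB rnormC pf.
have Pcauchy x n m : (n <= m)%N ->
    rnorm (poly_op (P m) T x - poly_op (P n) T x) <= (2 * rnorm x) * d n.
  move=> lenm; rewrite -poly_opB.
  rewrite (mulrC 2) -mulrA mulrC; apply: (poly_op_spectral_bound Hdot) => //.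
    by rewrite mulr_ge0// ltW.
  move=> z sz; rewrite !hornerE (le_trans (rnorm_dist _ (cfun f z) _))//.
  rewrite mulr_natl mulr2n lerD//; last by rewrite rnormBC Pf//.
  by rewrite (le_trans (Pf _ _ sz))// lef_pV2 ?posrE// ler_nat ltnS.
have /choice[S SP] x : exists l, forall n, rnorm (l - poly_op (P n) T x) <= (2 * rnorm x) * d n.
  apply: (complete_rate (Pcauchy x)).
  by rewrite -[X in _ --> X](mulr0 (2 * rnorm x)); apply: cvgMr; exact: cvg_harmonic.
have [_ _ P0Z _] := linear_morphs (poly_op_linear lT (P 0%N)).
exists S; split.
  apply/bounded_opP; split.
    move=> a x y; apply/eqP; rewrite -subr_eq0; apply/eqP.
    pose u := a *: x + y.
    apply: (@eq0_harmonic _ (2 * rnorm u + (rnorm a * (2 * rnorm x) + 2 * rnorm y))) => n.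
    have lP := poly_op_linear lT (P n).
    have -> : S (a *: x + y) - (a *: S x + S y) = (S u - poly_op (P n) T u)
        - (a *: (S x - poly_op (P n) T x) + (S y - poly_op (P n) T y)).
      by rewrite lP scalerBr (addrACA (a *: S x)) -opprD opprB addrA subrK.
    rewrite -/(d n) mulrDl (mulrDl (rnorm a * _)) -(mulrA (rnorm a)).
    rewrite (le_trans (rnormB _ _))// lerD// (le_trans (rnormD _ _))// lerD// rnormZ.
    by rewrite ler_wpM2l ?rnorm_ge0.
  have /bounded_opP[_ [K K0 PK]] := poly_op_bounded (P 0%N) bT.
  exists (2 + K); first by rewrite addr_ge0.
  move=> x; rewrite mulrDl (le_trans (rnorm_split _ (poly_op (P 0%N) T x)))// lerD//.
  by rewrite (le_trans (SP x _))// /d invr1 mulr1.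
move=> e e0; have e2 : 0 < e / 2 by rewrite divr_gt0.
have [N _ /(_ N (leqnn _))/= hN] := near_infty_natSinv_lt (PosNum e2).
have dN : d N < e / 2 by [].
exists (P N); split=> [z sz|x].
  by rewrite (le_trans (Pf _ _ sz))// (le_trans (ltW dN))// ler_piMr// ?ltW// invf_lt1// ltr1n.
rewrite rnormBC (le_trans (SP x _))// mulrAC ler_wpM2r ?rnorm_ge0//.
by rewrite mulrC -ler_pdivlMr// ltW.
Qed.

End PsdT.

(** The intertwining relation is clear for polynomials; the Weierstrass polynomials
of f on [0, M] approximate f(T) and f(T') simultaneously. *)
Lemma calculus_intertwine A T T' (M : R) f S S' : bounded_op A ->
    (forall x, A (T x) = T' (A x)) -> 0 < M ->
    psd T -> bounded_by M T -> psd T' -> bounded_by M T' -> quad_modulus M f ->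
    calculus T f S -> calculus T' f S' ->
  forall x, A (S x) = S' (A x).
Proof.
move=> /bounded_opP[lA [K K0 AK]] ATT M_gt0 pT TM pT' TM' fM Sf Sf' x.
have M0 := ltW M_gt0; have [_ AB _ _] := linear_morphs lA.
apply/eqP; rewrite -subr_eq0; apply/eqP.
apply: (@eq0_harmonic _ (2 * K * rnorm x)) => n.
have d0 : 0 < n.+1%:R^-1 :> R by rewrite invr_gt0.
have [p pf] := weierstrass M_gt0 fM d0; set d := n.+1%:R^-1 in d0 pf *.
have close U V : psd U -> bounded_by M U -> calculus U f V ->
    bounded_by d (fun x => poly_op (map_poly (real_complex R) p) U x - V x).
  move=> pU UM Vf; have h := calculusB (calculus_poly M0 pU UM p) Vf.
  apply: (calculus_bound M0 pU UM (ltW d0) _ h) => z sz.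
  have [r rM [_ ->]] := spectrum_cfun M0 pU UM sz.
  by rewrite rnormC pf.
have -> : A (S x) - S' (A x)
  = - A (poly_op (map_poly (real_complex R) p) T x - S x)
    + (poly_op (map_poly (real_complex R) p) T' (A x) - S' (A x)).
  rewrite AB opprB (poly_op_intertwine _ _ lA ATT) addrA subrK//.
rewrite (le_trans (rnormD _ _))// rnormN.
have h1 := le_trans (AK _) (ler_wpM2l K0 (close _ _ pT TM Sf x)).
have h2 := le_trans (close _ _ pT' TM' Sf' (A x)) (ler_wpM2l (ltW d0) (AK x)).
rewrite (le_trans (lerD h1 h2))// le_eqVlt; apply/orP; left.
by apply/eqP; ring.
Qed.

End Calculus.

(** * Mixed Schwarz inequality and the numerical radius *)

Section PowerInequalities.
Variable R : realType.
Implicit Types (r v w t e : R).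

(** Follows from the factorization r^2 = r^(2(1-t)) r^(2t). *)
Lemma powR_quotient_le r t e : 0 <= r -> 0 < e ->
  (r `^ (2 * (1 - t)) + e)^-1 * (r * r) <= r `^ (2 * t).
Proof.
move=> r0 e0; have u0 : 0 < r `^ (2 * (1 - t)) + e by rewrite ltr_wpDl ?powR_ge0.
have [->|rn0] := eqVneq r 0; first by rewrite !mulr0 powR_ge0.
rewrite ler_pdivrMl//.
have -> : r * r = r `^ (2 * (1 - t)) * r `^ (2 * t).
  rewrite -powRD ?rn0 ?implybT//.
  have -> : 2 * (1 - t) + 2 * t = 2%:R by ring.
  by rewrite powR_mulrn// expr2.
by rewrite ler_wpM2r ?powR_ge0// lerDl ltW.
Qed.

(** The endpoints t = 0 and t = 1 are excluded from Young's inequality, since the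
conjugate exponents 1 / (1 - t) and 1 / t must be finite. *)
Lemma weighted_young v w t : 0 <= v -> 0 <= w -> 0 <= t <= 1 ->
  v `^ (2 * (1 - t)) * w `^ (2 * t) <= (1 - t) * v `^ 2 + t * w `^ 2.
Proof.
move=> v0 w0 /andP[t0 t1]; have [->|tn0] := eqVneq t 0.
  by rewrite subr0 mulr1 mulr0 powRr0 mulr1 mul1r mul0r addr0.
have [->|tn1] := eqVneq t 1.
  by rewrite subrr mulr0 powRr0 mulr1 !mul1r mul0r add0r.
have s0 : 0 < 1 - t by rewrite subr_gt0 lt_neqAle tn1.
have t_gt0 : 0 < t by rewrite lt_def tn0.
have := @conjugate_powR _ (v `^ (2 * (1 - t))) (w `^ (2 * t)) (1 - t)^-1 t^-1.
rewrite -!powRrM !mulfK ?gt_eqF// !invrK !powR_ge0 !invr_gt0 subrK.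
by rewrite ![_ `^ 2 * _]mulrC; apply.
Qed.

End PowerInequalities.

Section OperatorPowers.
Variables (R : realType) (H : completeNormedModType R[i]).
Variables (dot : {dot H for Num.conj}).
Hypothesis Hdot : forall x : H, dot x x = `|x| ^+ 2.
Implicit Types (x y : H) (T S : H -> H) (f g : R -> R).
Local Notation rdot := (rdot dot).
Local Notation psd := (psd dot).

Lemma psd_bounded_by T : psd T -> bounded_op T -> exists2 K, 0 < K & bounded_by K T.
Proof.
move=> _ /bounded_opP[_ [K K0 TK]]; exists (K + 1); first by rewrite ltr_wpDl.
by apply: bounded_by_le TK; rewrite lerDl.
Qed.

Lemma op_powR_calculus T (s : R) : psd T -> bounded_op T -> 0 <= s ->
  calculus T (fun r => r `^ s) (op_powR T s).
Proof.
move=> pT bT s0; have [M M_gt0 TM] := psd_bounded_by pT bT.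
have [S TS] := calculus_exists Hdot (ltW M_gt0) pT TM M_gt0
  (quad_modulus_powR (ltW M_gt0) s0).
apply/(calculusP _ _ bT).
apply: (@xgetPex _ 0 [set S | is_cfc T (cfun (fun r => r `^ s)) S]).
by exists S; apply/calculusP.
Qed.

Lemma psd_sqrt T : psd T -> bounded_op T -> let S := op_powR T 2^-1 in
  [/\ bounded_op S, psd S & forall x, S (S x) = T x].
Proof.
move=> pT bT S; have [M M_gt0 TM] := psd_bounded_by pT bT.
have M0 := ltW M_gt0.
have cS : calculus T (fun r => r `^ 2^-1) S by apply: op_powR_calculus.
split; first by case: cS.
  by apply: (calculus_psd Hdot M0 pT TM _ cS) => r _; exact: powR_ge0.
move=> x; have := calculusM Hdot M0 pT TM cS cS.
move=> /(calculus_eq Hdot M0 pT TM (g := fun r => r)) h.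
have /h cSS : forall r, 0 <= r <= M -> r `^ 2^-1 * r `^ 2^-1 = r.
  by move=> r /andP[r0 _]; rewrite powR12_sqrt// -expr2 sqr_sqrtr.
by rewrite -[LHS]/((S \o S) x) (calculus_inj Hdot M0 pT TM cSS (calculusX Hdot M0 pT TM)).
Qed.

(** An affine inequality between functions of T can be evaluated at a vector state;
this is how Jensen-type inequalities are derived here. *)
Lemma calculus_affine_le T f g S S' (c d e : R) x : psd T -> bounded_op T ->
    (forall r, 0 <= r -> c * f r <= d + e * g r) ->
    calculus T f S -> calculus T g S' ->
  c * rdot (S x) x <= d * rnorm x ^+ 2 + e * rdot (S' x) x.
Proof.
move=> pT bT fg Sf Sg; have [M M_gt0 TM] := psd_bounded_by pT bT.
have M0 := ltW M_gt0; have c1 := calculus1 Hdot M0 pT TM.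
have h1 := calculus_lin c 0 Sf c1; have h2 := calculus_lin d e c1 Sg.
have := calculus_le Hdot M0 pT TM x _ h1 h2.
rewrite !rdotDl !rdotZl (rdot_rnorm Hdot) !mul0r !addr0; apply => r /andP[r0 _].
by rewrite addr0 mulr1 fg.
Qed.

Section MixedSchwarz.
Variables (A A' S S' : H -> H).
Hypotheses (bA : bounded_op A) (AA' : adjoint_of dot A A').
Hypotheses (bS : bounded_op S) (pS : psd S) (bS' : bounded_op S') (pS' : psd S').
Hypothesis S'2 : forall x, S' (S' x) = A (A' x).
Hypothesis AS : forall x, A (S x) = S' (A x).

(** Stated for any positive S, S' with A S = S' A and S'^2 = A A^*; in the
application S = |A| and S' = |A^*|. *)
Lemma mixed_schwarz (t : R) P Q x : 0 <= t <= 1 ->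
    calculus S (fun r => r `^ (2 * (1 - t))) P ->
    calculus S' (fun r => r `^ (2 * t)) Q ->
  rnorm (dot (A x) x) ^+ 2 <= rdot (P x) x * rdot (Q x) x.
Proof.
move=> /andP[t0 t1] cP cQ.
have [K K_gt0 SK] := psd_bounded_by pS bS.
have [K' K'_gt0 SK'] := psd_bounded_by pS' bS'.
pose M := Num.max K K'.
have M_gt0 : 0 < M by rewrite lt_max K_gt0.
have SM : bounded_by M S by apply: bounded_by_le SK; rewrite le_max lexx.
have SM' : bounded_by M S' by apply: bounded_by_le SK'; rewrite le_max lexx orbT.
have M0 := ltW M_gt0.
pose s := 2 * (1 - t).
have s0 : 0 <= s by rewrite mulr_ge0// subr_ge0.
have Q_ge0 : 0 <= rdot (Q x) x.
  have [|//] := calculus_psd Hdot M0 pS' SM' _ cQ.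
  by move=> r _; exact: powR_ge0.
rewrite -subr_ge0; apply: (@ge0_harmonic _ _ (rdot (Q x) x * rnorm x ^+ 2)) => n.
have e0 : 0 < n.+1%:R^-1 :> R by rewrite invr_gt0.
set e := n.+1%:R^-1 in e0 *.
pose f r := r `^ s + e.
have f_gt0 r : 0 < f r by rewrite ltr_wpDl ?powR_ge0.
pose F y := P y + e%:C *: y.
have cF : calculus S f F.
  have := calculus_lin 1 e cP (calculus1 Hdot M0 pS SM); congr calculus.
    by apply/funext => r; rewrite mul1r mulr1.
  by apply/funext => y; rewrite rmorph1 scale1r.
have pF : psd F by apply: (calculus_psd Hdot M0 pS SM _ cF) => r _; exact: ltW.
have g_mod : quad_modulus M (fun r => (f r)^-1).
  apply: quad_modulus_inv => //; first exact: quad_modulus_powR.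
  by move=> r _; exact: powR_ge0.
have [G cG] := calculus_exists Hdot M0 pS SM M_gt0 g_mod.
have [G' cG'] := calculus_exists Hdot M0 pS' SM' M_gt0 g_mod.
have FG y : F (G y) = y.
  have := calculus_eq Hdot M0 pS SM _ (calculusM Hdot M0 pS SM cF cG).
  move=> /(_ (fun=> 1)) h; rewrite -[LHS]/((F \o G) y).
  rewrite (calculus_inj Hdot M0 pS SM (h _) (calculus1 Hdot M0 pS SM))//.
  by move=> r _; rewrite divff// gt_eqF.
have AG := calculus_intertwine Hdot bA AS M_gt0 pS SM pS' SM' g_mod cG cG'.
have cX := calculusX Hdot M0 pS' SM'.
have cGSS := calculusM Hdot M0 pS' SM' cG' (calculusM Hdot M0 pS' SM' cX cX).
have GQ : rdot (A' x) (G (A' x)) <= rdot (Q x) x.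
  rewrite (rdotC dot) {1}/rdot -AA' AG -S'2.
  apply: (calculus_le Hdot M0 pS' SM' _ _ cGSS cQ) => r /andP[r0 _].
  exact: powR_quotient_le.
have [_ sF _] := pF.
have -> : dot (A x) x = dot (F x) (G (A' x)) by rewrite AA' sF FG.
have := psd_cauchy_schwarz x (G (A' x)) pF; rewrite FG => h.
have Fx : rdot (F x) x = rdot (P x) x + e * rnorm x ^+ 2.
  by rewrite rdotDl rdotZl (rdot_rnorm Hdot).
have Fx0 : 0 <= rdot (F x) x by case: pF.
have := le_trans h (ler_wpM2r Fx0 GQ); rewrite Fx.
set u := rnorm (dot _ _) ^+ 2; set q := rdot (Q x) x; set p := rdot (P x) x.
set m := rnorm x ^+ 2; lra.
Qed.

Lemma numerical_bound (t : R) P2 Q2 S2 S2' x : rnorm x = 1 -> 0 <= t <= 1 ->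
    calculus S (fun r => r `^ (4 * (1 - t))) P2 ->
    calculus S' (fun r => r `^ (4 * t)) Q2 ->
    calculus S (fun r => r `^ 2) S2 -> calculus S' (fun r => r `^ 2) S2' ->
  rnorm (dot (A x) x) ^+ 2 <= (rdot (P2 x) x + rdot (Q2 x) x) / 4
    + ((1 - t) * rdot (S2 x) x + t * rdot (S2' x) x) / 2.
Proof.
move=> x1 t01 cP2 cQ2 cS2 cS2'; have /andP[t0 t1] := t01.
have s0 : 0 <= 1 - t by rewrite subr_ge0.
have [P cP] : exists P, calculus S (fun r => r `^ (2 * (1 - t))) P.
  by eexists; apply: op_powR_calculus; rewrite ?mulr_ge0.
have [Q cQ] : exists Q, calculus S' (fun r => r `^ (2 * t)) Q.
  by eexists; apply: op_powR_calculus; rewrite ?mulr_ge0.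
have := mixed_schwarz x t01 cP cQ.
set p := rdot (P x) x; set q := rdot (Q x) x => pq.
have sqr_powR (r u : R) : r `^ (4 * u) = (r `^ (2 * u)) ^+ 2.
  rewrite -powR_mulrn ?powR_ge0// -powRrM; congr (_ `^ _); ring.
have square (T V V2 : H -> H) (u : R) : psd T -> bounded_op T ->
    calculus T (fun r => r `^ (2 * u)) V -> calculus T (fun r => r `^ (4 * u)) V2 ->
    rdot (V x) x ^+ 2 <= rdot (V2 x) x.
  move=> pT bT cTV cTV2.
  set m := rdot (V x) x.
  have : 2 * m * m <= m ^+ 2 * rnorm x ^+ 2 + 1 * rdot (V2 x) x.
    apply: (calculus_affine_le x pT bT _ cTV cTV2) => r _; rewrite sqr_powR.
    by have := sqr_ge0 (m - r `^ (2 * u)); set v := r `^ _; nra.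
  by rewrite x1 expr1n mulr1 mul1r mulr2n !mulrDl !mul1r -expr2 lerD2l.
have pP2 := square _ _ _ _ pS bS cP cP2.
have qQ2 := square _ _ _ _ pS' bS' cQ cQ2.
have young w : 0 <= w ->
    w `^ (2 * t) * p <= t * w `^ 2 + (1 - t) * rdot (S2 x) x.
  move=> w0; have := calculus_affine_le x pS bS _ cP cS2.
  move=> /(_ (w `^ (2 * t)) (t * w `^ 2) (1 - t)); rewrite x1 expr1n mulr1.
  apply=> r r0; have := weighted_young r0 w0 t01.
  by rewrite [leRHS]addrC [leLHS]mulrC.
have pq_le : p * q <= (1 - t) * rdot (S2 x) x + t * rdot (S2' x) x.
  have := calculus_affine_le x pS' bS' _ cQ cS2'.
  move=> /(_ p ((1 - t) * rdot (S2 x) x) t); rewrite x1 expr1n mulr1.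
  apply=> r r0; have := young r r0.
  by rewrite [leRHS]addrC [leLHS]mulrC.
have pq2 : 2 * (p * q) <= p ^+ 2 + q ^+ 2.
  by rewrite -subr_ge0 [leRHS](_ : _ = (p - q) ^+ 2) ?sqr_ge0//; ring.
move: pq pP2 qQ2 pq_le pq2; rewrite -/p -/q.
set a := rdot _ _; set b := rdot _ _; set c := (1 - t) * _ + _.
set u := p * q; set v := p ^+ 2; set w := q ^+ 2; lra.
Qed.

Lemma numerical_radius_bound (t : R) P2 Q2 S2 S2' : 0 <= t <= 1 ->
    calculus S (fun r => r `^ (4 * (1 - t))) P2 ->
    calculus S' (fun r => r `^ (4 * t)) Q2 ->
    calculus S (fun r => r `^ 2) S2 -> calculus S' (fun r => r `^ 2) S2' ->
  numerical_radius dot A ^+ 2 <=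
  opnorm ((4 : R[i])^-1 *: (P2 + Q2)
          + (2 : R[i])^-1 *: ((1 - t)%:C *: S2 + t%:C *: S2')).
Proof.
move=> t01 cP2 cQ2 cS2 cS2'; set K := (X in opnorm X).
have inv4 : (4 : R[i])^-1 = (4^-1)%:C by rewrite fmorphV rmorph_nat.
have inv2 : (2 : R[i])^-1 = (2^-1)%:C by rewrite fmorphV rmorph_nat.
have KE : K = fun x => (4^-1)%:C *: (P2 x + Q2 x)
    + (2^-1)%:C *: ((1 - t)%:C *: S2 x + t%:C *: S2' x).
  by apply/funext => x; rewrite -inv4 -inv2.
have bK : bounded_op K.
  have [[bP2 _] [bQ2 _]] := (cP2, cQ2); have [[bS2 _] [bS2' _]] := (cS2, cS2').
  rewrite KE; apply: bounded_opD; apply: bounded_opZ.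
    exact: bounded_opD.
  by apply: bounded_opD; apply: bounded_opZ.
have bound x : rnorm x = 1 -> rnorm (dot (A x) x) ^+ 2 <= opnorm K.
  move=> x1; apply: le_trans (numerical_bound x1 t01 cP2 cQ2 cS2 cS2') _.
  have := rdot_bounded Hdot x (opnorm_bound bK); rewrite x1 expr1n mulr1 KE.
  by rewrite !(rdotDl, rdotZl) mulrC [X in _ + X]mulrC.
have K0 := opnorm_ge0 K.
rewrite -[leRHS](sqr_sqrtr K0); apply: lerXn2r.
- rewrite nnegrE /numerical_radius; set B := (X in sup X).
  have [[[y By] hB]|nB] := pselect (has_sup B); last by rewrite sup_out.
  apply: (le_trans _ (sup_upper_bound _ By)); last by split => //; exists y.
  by case: By => x _ <-; exact: (rnorm_ge0 (dot (A x) x)).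
- by rewrite nnegrE sqrtr_ge0.
rewrite /numerical_radius; set B := (X in sup X).
have [->|/set0P B0] := eqVneq B set0; first by rewrite sup0 sqrtr_ge0.
apply: ge_sup => // _ [x /= x1 <-].
suff : rnorm (dot (A x) x) <= Num.sqrt (opnorm K) by [].
rewrite -(@ler_pXn2r _ 2) ?nnegrE ?rnorm_ge0 ?sqrtr_ge0// sqr_sqrtr//.
by apply: bound; rewrite /rnorm x1.
Qed.

End MixedSchwarz.

End OperatorPowers.

Theorem theorem2p6 (R : realType) (H : completeNormedModType R[i])
    (dot : {dot H for Num.conj}) (Hdot : forall x : H, dot x x = `|x| ^+ 2)
    (A : H -> H) (HA : bounded_op A) :
  let absA := op_abs dot A in
  let absA' := op_abs dot (adjoint dot A) in
  numerical_radius dot A ^+ 2 <=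
  inf [set opnorm
         ((4 : R[i])^-1 *:
            (op_powR absA (4 * (1 - t)) + op_powR absA' (4 * t))
          + (2 : R[i])^-1 *:
            ((1 - t)%:C *: op_powR absA 2 + t%:C *: op_powR absA' 2))
      | t in `[(0 : R), 1]].
Proof.
cbv zeta; set S := op_abs dot A; set S' := op_abs dot (adjoint dot A).
have [bA' AA'] := adjointP Hdot HA; have A'A := adjoint_ofC AA'.
have lA := bounded_op_lin HA; have lA' := bounded_op_lin bA'.
have pT : psd dot (adjoint dot A \o A).
  split => [a x y|x y|x] /=; first by rewrite lA lA'.
    by rewrite A'A AA'.
  by rewrite /rdot A'A (dot_rnorm Hdot) sqr_ge0.
have pT' : psd dot (A \o adjoint dot A).
  split => [a x y|x y|x] /=; first by rewrite lA' lA.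
    by rewrite AA' A'A.
  by rewrite /rdot AA' (dot_rnorm Hdot) sqr_ge0.
have bT := bounded_op_comp bA' HA; have bT' := bounded_op_comp HA bA'.
(* The adjoint of the adjoint of A is A. *)
have ES' : S' = op_powR (A \o adjoint dot A) 2^-1.
  by rewrite /S' /op_abs (adjointK Hdot HA).
have [bS pS _] := psd_sqrt Hdot pT bT.
have [bS' pS' SS'] := psd_sqrt Hdot pT' bT'.
have AS x : A (op_powR (adjoint dot A \o A) 2^-1 x)
    = op_powR (A \o adjoint dot A) 2^-1 (A x).
  have h0 : 0 <= 2^-1 :> R by rewrite invr_ge0.
  have cS := op_powR_calculus Hdot pT bT h0.
  have cS' := op_powR_calculus Hdot pT' bT' h0.
  have [M M_gt0 TM] := psd_bounded_by pT bT.
  have [M' M'_gt0 TM'] := psd_bounded_by pT' bT'.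
  have m_gt0 : 0 < Num.max M M' by rewrite lt_max M_gt0.
  apply: (calculus_intertwine Hdot HA _ m_gt0 pT _ pT' _ _ cS cS') => //.
  - by apply: bounded_by_le TM; rewrite le_max lexx.
  - by apply: bounded_by_le TM'; rewrite le_max lexx orbT.
  - by apply: quad_modulus_powR => //; exact: ltW.
rewrite -/S in bS pS AS; rewrite -ES' in bS' pS' SS' AS.
apply: lb_le_inf => [|_ [t /= t01 <-]].
  by eexists; exists 0; [rewrite /= in_itv/= lexx ler01 | reflexivity].
rewrite in_itv/= in t01; have /andP[t0 t1] := t01.
have s0 : 0 <= 1 - t by rewrite subr_ge0.
apply: (numerical_radius_bound Hdot HA AA' bS pS bS' pS' SS' AS t01).
- by apply: op_powR_calculus; rewrite ?mulr_ge0.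
- by apply: op_powR_calculus; rewrite ?mulr_ge0.
- exact: op_powR_calculus.
- exact: op_powR_calculus.
Qed.
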